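(* Let $k\ge 3$ be an integer. There exist constants $c=c(k)>0$ and $n_0=n_0(k)$ such that for every $n\ge n_0$: if $G$ is a graph on $n$ vertices with $q(G)\ge q(T_{n,k})$ and $G$ is not isomorphic to $T_{n,k}$, then $js_{k+1}(G)\ge c\,n^{k-1}$.
   Context: All graphs are finite and simple. $q(G)$ denotes the largest eigenvalue of the signless Laplacian $Q(G)=D(G)+A(G)$. $T_{n,k}$ is the complete $k$-partite graph on $n$ vertices with part sizes differing by at most one. An $r$-joint of size $t$ is a collection of $t$ copies of $K_r$ all containing a common edge; $js_r(G)$ is the maximum, over all edges $uv$ of $G$, of the number of copies of $K_r$ in $G$ containing both $u$ and $v$. *)

(* Defs.v *)
From HB Require Import structures.
From mathcomp Require Import all_boot all_order all_algebra.
From mathcomp Require Import fingroup perm classical_sets reals.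
Set Implicit Arguments. Unset Strict Implicit. Unset Printing Implicit Defensive.
Import Order.TTheory GRing.Theory Num.Theory.
Local Open Scope ring_scope.

Definition simple_graph (n : nat) (e : rel 'I_n) : Prop :=
  (forall i j, e i j = e j i) /\ (forall i, ~~ e i i).

Definition deg (n : nat) (e : rel 'I_n) (i : 'I_n) : nat := #|[set j | e i j]|.

Definition signless_laplacian (R : realType) (n : nat) (e : rel 'I_n) : 'M[R]_n :=
  \matrix_(i, j) ((if i == j then (deg e i)%:R else 0) + (e i j)%:R).

(* q(G): largest eigenvalue of Q(G) (all eigenvalues are real, Q being symmetric) *)
Definition q (R : realType) (n : nat) (e : rel 'I_n) : R :=
  sup [set x : R | eigenvalue (signless_laplacian R e) x].

(* Turan graph T_{n,k}: complete k-partite graph with parts {i : i mod k = r},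
   whose sizes differ by at most one. *)
Definition turan (n k : nat) : rel 'I_n := fun i j => (i %% k != j %% k)%N.

Definition isomorphic (n : nat) (e1 e2 : rel 'I_n) : Prop :=
  exists f : {perm 'I_n}, forall i j, e1 i j = e2 (f i) (f j).

Definition clique (n : nat) (e : rel 'I_n) (S : {set 'I_n}) : bool :=
  [forall i in S, forall j in S, (i != j) ==> e i j].

Definition nKr_through (n r : nat) (e : rel 'I_n) (u v : 'I_n) : nat :=
  #|[set S : {set 'I_n} | [&& u \in S, v \in S, #|S| == r & clique e S]]|.

Definition js (n r : nat) (e : rel 'I_n) : nat :=
  \max_(p : 'I_n * 'I_n | e p.1 p.2) nKr_through r e p.1 p.2.

Arguments turan n k : clear implicits.
Arguments q R {n} e.
Arguments signless_laplacian R {n} e.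
Arguments js {n} r e.

(* Main.v *)
Require Import Defs.
From HB Require Import structures.
From mathcomp Require Import all_boot all_order all_algebra.
From mathcomp Require Import fingroup perm classical_sets reals boolp.
From mathcomp Require Import topology normedtype derive.
(* Imported again because [classical_sets] shadows the names of [finset]. *)
From mathcomp Require Import fintype finset ring lra zify.
Set Implicit Arguments. Unset Strict Implicit. Unset Printing Implicit Defensive.
Import Order.TTheory GRing.Theory Num.Theory.
Import numFieldNormedType.Exports.
Local Open Scope ring_scope.

(** For an eigenvector x of q(G) let w be a vertex where x is smallest. If some degree is
    below q/2 - eps n, the eigenvalue equation at that vertex forces x_w^2 to be well below
    |x|^2 / n, so deleting w increases the ratio q/n by a constant times 1/n. Maximize
    q(G[S])/|S| plus a small multiple of the harmonic sum of |S|: since the ratio is at most 2,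
    the maximizer S has linear size, and all its degrees exceed (1 - 1/k - 2 eps)|S|.

    If no edge lies in many copies of K_{k+1}, greedy extension shows that the
    non-neighbourhoods of the two ends of an edge of G[S] are almost disjoint. The
    non-neighbourhoods of the vertices of a k-clique then almost partition S, and every
    vertex misses completely the common neighbourhood of some k-1 vertices of the clique;
    this colours G[S] properly with k colours.

    For a k-partite graph with part sizes n_i, summing the eigenvalue equation over the parts
    gives sum_i n_i / (q - n + 2 n_i) >= 1, with equality exactly for complete k-partite graphs.
    By concavity q(G[S]) <= 2 (1 - 1/k) |S|, so nothing was deleted; and the comparison with
    the identity for T_{n,k} forces balanced parts and completeness. *)

(** * Elementary facts on sums and quadratics *)

Lemma sum_delta (R : realType) (n : nat) (i : 'I_n) (g : 'I_n -> R) :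
  \sum_j (j == i)%:R * g j = g i.
Proof.
rewrite (bigD1 i) //= eqxx mul1r big1 ?addr0 // => j /negPf ->.
by rewrite mul0r.
Qed.

(** First-order condition at a minimum: for [t] small and of sign opposite to [b], the linear term
    would dominate and make the expression negative. *)
Lemma linear_coef_eq0 (R : realType) (b c : R) :
  (forall t, 0 <= t * b + t ^+ 2 * c) -> b = 0.
Proof.
move=> H; apply/eqP; case: eqP => // /eqP b0.
have c1 : 0 < 1 + `|c| by rewrite ltr_pwDl.
have cc := ler_norm c.
(* At [t = - s] the expression equals [s ^+ 2 * (c - 1 - |c|)], which is negative unless [s = 0]. *)
pose s := b / (1 + `|c|).
have bs : b = s * (1 + `|c|) by rewrite /s mulfVK // gt_eqF.
have s0 : s != 0 by apply: contraNneq b0 => h; rewrite bs h mul0r.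
have s2 : 0 < s ^+ 2 by rewrite lt_neqAle sqr_ge0 andbT eq_sym expf_neq0.
have := H (- s); rewrite bs.
have -> : - s * (s * (1 + `|c|)) + (- s) ^+ 2 * c = s ^+ 2 * (c - 1 - `|c|) by ring.
rewrite pmulr_rge0 //; lra.
Qed.

(** * The signless Laplacian form and its top eigenvector *)

(** The sum runs over ordered pairs, so for symmetric [e] this is twice $x^T Q x$; hence the factors
    2 in the Rayleigh bounds below. *)
Definition qform {R : realType} {n : nat} (e : rel 'I_n) (x : 'I_n -> R) : R :=
  \sum_i \sum_j (e i j)%:R * (x i + x j) ^+ 2.

(** Splitting [z i + z j] gives two halves that are exchanged by swapping [i] and [j]. *)
Lemma qform_half (R : realType) (n : nat) (e : rel 'I_n) (x z : 'I_n -> R) :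
  (forall i j, e i j = e j i) ->
  \sum_i \sum_j (e i j)%:R * ((x i + x j) * (z i + z j)) =
  2 * \sum_i z i * \sum_j (e i j)%:R * (x i + x j).
Proof.
move=> sym.
have h : \sum_i \sum_j (e i j)%:R * ((x i + x j) * z j) =
         \sum_i z i * \sum_j (e i j)%:R * (x i + x j).
  rewrite exchange_big; apply: eq_bigr => i _; rewrite big_distrr /=.
  by apply: eq_bigr => j _; rewrite sym; ring.
rewrite mulr_natl mulr2n -{1}h -big_split /=.
apply: eq_bigr => i _; rewrite big_distrr -big_split /=.
by apply: eq_bigr => j _; ring.
Qed.

Lemma qform_shift (R : realType) (n : nat) (e : rel 'I_n) (x z : 'I_n -> R) (t : R) :
  (forall i j, e i j = e j i) ->
  qform e (fun i => x i + t * z i) =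
  qform e x + t * (4 * \sum_i z i * \sum_j (e i j)%:R * (x i + x j)) + t ^+ 2 * qform e z.
Proof.
move=> sym; have -> : 4 = 2 * 2 :> R by ring.
rewrite -(mulrA 2) -(@qform_half R n e x z sym) /qform !big_distrr -!big_split /=.
apply: eq_bigr => i _; rewrite !big_distrr -!big_split /=.
by apply: eq_bigr => j _; ring.
Qed.

Lemma continuous_sum (R : realType) (T : topologicalType) (I : finType) (f : I -> T -> R) :
  (forall i, continuous (f i)) -> continuous (fun x => \sum_i f i x).
Proof.
move=> H x; apply: cvg_big => [|i _]; last exact: H.
exact: add_continuous.
Qed.

Lemma unit_sphere_compact (R : realType) (n : nat) :
  compact [set v : 'rV[R]_n | \sum_i (v ord0 i) ^+ 2 = 1]%classic.
Proof.
apply: (@subclosed_compact _ _ [set v : 'rV[R]_n | forall i, `[-1, 1]%classic (v ord0 i)]).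
- apply: (@preimage_closed _ _ (fun v : 'rV[R]_n => \sum_i (v ord0 i) ^+ 2) [set x | x = 1]%classic);
    last exact: closed_eq.
  move=> v _; apply: continuous_sum => i w.
  by apply: continuousM; apply: coord_continuous.
- exact: (@rV_compact R n (fun=> `[-1, 1]%classic) (fun=> @segment_compact R _ _)).
- move=> v /= v1 i; rewrite in_itv /= -ler_norml -(@ler_pXn2r _ 2) ?nnegrE //.
  rewrite expr1n real_normK ?num_real // -v1 (bigD1 i) //= lerDl.
  by apply: sumr_ge0 => j _; apply: sqr_ge0.
Qed.

Lemma continuous_qform (R : realType) (n : nat) (e : rel 'I_n) :
  continuous (fun v : 'rV[R]_n => qform e (fun i => v ord0 i)).
Proof.
apply: continuous_sum => i; apply: continuous_sum => j v.
have h : {for v, continuous (fun v : 'rV[R]_n => v ord0 i + v ord0 j)}.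
  by apply: continuousD; apply: coord_continuous.
have c : {for v, continuous (fun _ : 'rV[R]_n => (e i j)%:R : R)} by exact: cst_continuous.
exact: continuousM c (continuousM h h).
Qed.

Lemma qform_scale (R : realType) (n : nat) (e : rel 'I_n) (t : R) (x : 'I_n -> R) :
  qform e (fun i => t * x i) = t ^+ 2 * qform e x.
Proof.
rewrite /qform big_distrr /=; apply: eq_bigr => i _; rewrite big_distrr /=.
by apply: eq_bigr => j _; ring.
Qed.

Lemma sumsq_eq0 (R : realType) (n : nat) (x : 'I_n -> R) :
  \sum_i x i ^+ 2 = 0 -> forall i, x i = 0.
Proof.
move=> /eqP; rewrite psumr_eq0 => [/allP h i|i _]; last exact: sqr_ge0.
by apply/eqP; have := h i (mem_index_enum _); rewrite /= sqrf_eq0.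
Qed.

(** A maximizer on the unit sphere exists by compactness. Passing to absolute values of its entries
    keeps the norm and cannot decrease the form, and homogeneity carries the bound from the sphere
    to all vectors. *)
Lemma qform_max (R : realType) (n : nat) (e : rel 'I_n) : (0 < n)%N ->
  exists x : 'I_n -> R, [/\ forall i, 0 <= x i, \sum_i x i ^+ 2 = 1 &
    forall y, qform e y <= qform e x * \sum_i y i ^+ 2].
Proof.
case: n e => // n e _.
have [] := @EVT_max_rV R n.+1 (fun v => qform e (fun i => v ord0 i)) _ _
  (@unit_sphere_compact R n.+1).
- exists (delta_mx ord0 ord0) => /=; rewrite (bigD1 ord0) //= big1 => [|j /negPf j0].
    by rewrite mxE !eqxx expr1n addr0.
  by rewrite mxE j0 andbF expr0n.
- by apply: continuous_subspaceT; exact: continuous_qform.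
move=> v /set_mem /= v1 vmax; exists (fun i => `|v ord0 i|).
have leabs : qform e (fun i => v ord0 i) <= qform e (fun i => `|v ord0 i|).
  apply: ler_sum => i _; apply: ler_sum => j _; apply: ler_wpM2l => //.
  by rewrite -real_normK ?num_real // ler_sqr ?nnegrE ?ler_normD // addr_ge0.
split=> // [|y].
  by rewrite -[RHS]v1; apply: eq_bigr => i _; rewrite real_normK ?num_real.
set s := \sum_i _; have s0 : 0 <= s by apply: sumr_ge0 => i _; exact: sqr_ge0.
have [s_eq0|s_neq0] := eqVneq s 0.
  rewrite s_eq0 mulr0 /qform big1 // => i _; rewrite big1 // => j _.
  by rewrite !(sumsq_eq0 s_eq0) addr0 expr0n mulr0.
have s_gt0 : 0 < s by rewrite lt_neqAle eq_sym s_neq0.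
pose r := Num.sqrt s.
have rs : r ^+ 2 = s by rewrite sqr_sqrtr.
have r0 : r != 0 by apply: contraNneq s_neq0 => h; rewrite -rs h expr0n.
pose w : 'rV[R]_n.+1 := \row_i (r^-1 * y i).
have qw : qform e (fun i => w ord0 i) = s^-1 * qform e y.
  rewrite -rs -exprVn -qform_scale; apply: eq_bigr => i _.
  by apply: eq_bigr => j _; rewrite !mxE.
rewrite mulrC -ler_pdivrMl // -qw; apply: le_trans leabs; apply: vmax.
apply/mem_set => /=; under eq_bigr do rewrite mxE exprMn.
by rewrite -big_distrr /= exprVn rs mulVf.
Qed.

Lemma sum_sq_shift (R : realType) (n : nat) (x z : 'I_n -> R) (t : R) :
  \sum_i (x i + t * z i) ^+ 2 =
  \sum_i x i ^+ 2 + t * (2 * \sum_i z i * x i) + t ^+ 2 * \sum_i z i ^+ 2.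
Proof.
by rewrite !big_distrr -!big_split /=; apply: eq_bigr => i _; ring.
Qed.

(** Perturbing the maximizer along the [i]-th basis vector leaves a quadratic in [t] that is
    nonnegative and vanishes at 0, so its linear coefficient, the eigenvalue equation at [i], is
    zero. *)
Lemma qform_max_eigen (R : realType) (n : nat) (e : rel 'I_n) (x : 'I_n -> R) (M : R) :
  (forall i j, e i j = e j i) ->
  qform e x = M * \sum_i x i ^+ 2 ->
  (forall y, qform e y <= M * \sum_i y i ^+ 2) ->
  forall i, M * x i = 2 * \sum_j (e i j)%:R * (x i + x j).
Proof.
move=> sym qx maxx i; pose z j : R := (j == i)%:R.
suff H : 2 * (M * x i) - 4 * \sum_j (e i j)%:R * (x i + x j) = 0 by lra.
apply: (@linear_coef_eq0 R _ (M * \sum_j z j ^+ 2 - qform e z)) => t.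
have := maxx (fun j => x j + t * z j).
rewrite qform_shift // sum_sq_shift -/z !(@sum_delta R n i) qx -subr_ge0.
congr (0 <= _); ring.
Qed.

Lemma qform_eigenvector (R : realType) (n : nat) (e : rel 'I_n) (x : 'I_n -> R) (a : R) :
  (forall i j, e i j = e j i) ->
  (forall i, a * x i = \sum_j (e i j)%:R * (x i + x j)) ->
  qform e x = 2 * a * \sum_i x i ^+ 2.
Proof.
move=> sym H; transitivity (\sum_i \sum_j (e i j)%:R * ((x i + x j) * (x i + x j))).
  by apply: eq_bigr => i _; apply: eq_bigr.
rewrite qform_half // -mulrA; congr (_ * _); rewrite big_distrr.
by apply: eq_bigr => i _; rewrite -H /=; ring.
Qed.

Lemma signless_laplacian_mul (R : realType) (n : nat) (e : rel 'I_n) (v : 'rV[R]_n) (i : 'I_n) :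
  (forall i j, e i j = e j i) ->
  (v *m signless_laplacian R e) ord0 i = \sum_j (e i j)%:R * (v ord0 i + v ord0 j).
Proof.
move=> sym; rewrite mxE; under eq_bigr do rewrite mxE mulrDr.
rewrite big_split /= (eq_bigr (fun j => (j == i)%:R * ((deg e j)%:R * v ord0 j))); last first.
  by move=> j _; case: eqP => [->|_] /=; ring.
rewrite sum_delta /deg -sum1_card natr_sum big_distrl /=.
under [RHS]eq_bigr do rewrite mulrDr.
rewrite big_split /=; congr (_ + _); last by apply: eq_bigr => j _; rewrite sym mulrC.
rewrite big_mkcond; apply: eq_bigr => j _; rewrite inE.
by case: (e i j) => /=; ring.
Qed.

(** Links the supremum defining [q] to the Rayleigh quotient: half the maximum of [qform] on the
    sphere is an eigenvalue, and it bounds every other one. From here on only these two consequences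
    are used. *)
Lemma q_spec (R : realType) (n : nat) (e : rel 'I_n) :
  (0 < n)%N -> (forall i j, e i j = e j i) ->
  [/\ forall y, qform e y <= 2 * q R e * \sum_i y i ^+ 2 &
      exists x : 'I_n -> R, [/\ forall i, 0 <= x i, \sum_i x i ^+ 2 = 1 &
        forall i, q R e * x i = \sum_j (e i j)%:R * (x i + x j)]].
Proof.
move=> n0 sym; have [x [x0 x1 xmax]] := @qform_max R n e n0.
pose M := qform e x / 2.
have xM : forall i, M * x i = \sum_j (e i j)%:R * (x i + x j).
  move=> i; have := @qform_max_eigen R n e x (qform e x) sym _ xmax i.
  by rewrite x1 mulr1 /M => /(_ erefl); lra.
suff -> : q R e = M.
  split=> [y|]; last by exists x.
  by have -> : 2 * M = qform e x by rewrite /M; field.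
have ubM : ubound [set a | eigenvalue (signless_laplacian R e) a]%classic M.
  move=> a /= /eigenvalueP[v va v0].
  have va' i : a * v ord0 i = \sum_j (e i j)%:R * (v ord0 i + v ord0 j).
    by rewrite -signless_laplacian_mul // va mxE.
  have := xmax (fun i => v ord0 i); rewrite (@qform_eigenvector R n e _ a) //.
  have s0 : 0 < \sum_i v ord0 i ^+ 2.
    rewrite lt_neqAle sumr_ge0 ?andbT => [|i _]; last exact: sqr_ge0.
    apply: contraNneq v0 => /esym h; apply/eqP/rowP => i; rewrite mxE.
    exact: (sumsq_eq0 h).
  by rewrite ler_pM2r // /M; lra.
have eigM : [set a | eigenvalue (signless_laplacian R e) a]%classic M.
  apply/eigenvalueP; exists (\row_i x i).
    by apply/rowP => i; rewrite signless_laplacian_mul // !mxE xM; under eq_bigr do rewrite !mxE.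
  apply/eqP => /rowP h; suff : \sum_i x i ^+ 2 = 0 by rewrite x1 => /eqP; rewrite oner_eq0.
  by rewrite big1 // => i _; have := h i; rewrite !mxE => ->; rewrite expr0n.
apply/eqP; rewrite eq_le ge_sup //=; last by exists M.
by apply: ub_le_sup => //; exists M.
Qed.

(** * Induced subgraphs and vertex deletion *)

(** Vertices outside [S] stay as isolated vertices. They only add eigenvalues 0, so [q] is unchanged
    and all subgraphs share one vertex type. *)
Definition restr (n : nat) (S : {set 'I_n}) (e : rel 'I_n) : rel 'I_n :=
  fun i j => [&& i \in S, j \in S & e i j].

Lemma restr_sym (n : nat) (S : {set 'I_n}) (e : rel 'I_n) :
  (forall i j, e i j = e j i) -> forall i j, restr S e i j = restr S e j i.
Proof. by move=> sym i j; rewrite /restr sym andbCA. Qed.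

Lemma deg_restr_le (n : nat) (S : {set 'I_n}) (e : rel 'I_n) (u : 'I_n) :
  (deg (restr S e) u <= #|S|)%N.
Proof. by apply: subset_leq_card; apply/fintype.subsetP => j; rewrite inE => /and3P[]. Qed.

Lemma sum_adj (R : realType) (n : nat) (e : rel 'I_n) (u : 'I_n) :
  \sum_j (e u j)%:R = (deg e u)%:R :> R.
Proof.
rewrite /deg -sum1_card natr_sum [RHS]big_mkcond; apply: eq_bigr => j _.
by rewrite inE; case: (e u j).
Qed.

Lemma sum_mem (R : realType) (n : nat) (S : {set 'I_n}) :
  \sum_j (j \in S)%:R = #|S|%:R :> R.
Proof.
rewrite -sum1_card natr_sum [RHS]big_mkcond; apply: eq_bigr => j _.
by case: (j \in S).
Qed.

(** In the eigenvalue equation at a largest entry [x i], each neighbour contributes at most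
    [2 * x i]. *)
Lemma q_le_card (R : realType) (n : nat) (S : {set 'I_n}) (e : rel 'I_n) :
  (0 < n)%N -> (forall i j, e i j = e j i) -> q R (restr S e) <= 2 * #|S|%:R.
Proof.
move=> n0 sym; have [_ [x [x0 x1 xq]]] := q_spec R n0 (@restr_sym _ S e sym).
pose i0 := Ordinal n0.
have [i _ imax] := @arg_maxP _ R _ i0 predT x erefl.
have xi : 0 < x i.
  rewrite lt_neqAle x0 andbT; apply/negP => /eqP h.
  have : \sum_j x j ^+ 2 = 0.
    rewrite big1 // => j _; have /eqP -> : x j == 0; last by rewrite expr0n.
    by rewrite eq_le x0 andbT h; apply: imax.
  by rewrite x1 => /eqP; rewrite oner_eq0.
rewrite -(ler_pM2r xi) xq.
apply: (@le_trans _ _ (\sum_j (restr S e i j)%:R * (2 * x i))).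
  apply: ler_sum => j _; apply: ler_wpM2l => //.
  by have := imax j isT; rewrite /=; lra.
rewrite -big_distrl /= sum_adj mulrCA mulrA ler_pM2r // ler_wpM2l //.
by rewrite ler_nat deg_restr_le.
Qed.

(** The sum of [a j * (x j - t) ^+ 2] is a nonnegative quadratic in [t]; evaluate it at the mean
    [A / d]. *)
Lemma weighted_cauchy (R : realType) (n : nat) (a : 'I_n -> bool) (x : 'I_n -> R) :
  (\sum_j (a j)%:R * x j) ^+ 2 <= (\sum_j (a j)%:R) * \sum_j (a j)%:R * x j ^+ 2.
Proof.
set A := \sum_j _ * x j; set d := \sum_j (a j)%:R; set s := \sum_j _.
have H t : 0 <= s - 2 * t * A + t ^+ 2 * d.
  have -> : s - 2 * t * A + t ^+ 2 * d = \sum_j (a j)%:R * (x j - t) ^+ 2.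
    rewrite /s /A /d !big_distrr -sumrB -big_split.
    by apply: eq_bigr => j _ /=; ring.
  by apply: sumr_ge0 => j _; rewrite mulr_ge0 ?sqr_ge0.
have [d0|d0] := eqVneq d 0.
  have aj j : (a j)%:R = 0 :> R.
    move/eqP: d0; rewrite psumr_eq0 => [/allP h|i _ //].
    by apply/eqP; have := h j (mem_index_enum _).
  by rewrite /A big1 ?expr0n ?d0 ?mul0r // => j _; rewrite aj mul0r.
have d_gt0 : 0 < d by rewrite lt_neqAle eq_sym d0 sumr_ge0.
have := H (A / d).
have -> : s - 2 * (A / d) * A + (A / d) ^+ 2 * d = (d * s - A ^+ 2) / d by field.
by rewrite pmulr_lge0 ?invr_gt0 // subr_ge0.
Qed.

(** Each vertex of [S] that is not a neighbour of [u] carries mass at least [y]. *)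
Lemma nbr_mass_le (R : realType) (n : nat) (S : {set 'I_n}) (e : rel 'I_n)
    (x : 'I_n -> R) (y : R) (u : 'I_n) :
  (forall j, j \in S -> y <= x j ^+ 2) ->
  \sum_j (restr S e u j)%:R * x j ^+ 2 + (#|S|%:R - (deg (restr S e) u)%:R) * y
    <= \sum_j x j ^+ 2.
Proof.
move=> ymin; rewrite -sum_mem -sum_adj -sumrB big_distrl -big_split /=.
apply: ler_sum => j _; have := ymin j; have := sqr_ge0 (x j); rewrite /restr.
by case: (j \in S); case: (u \in S); case: (e u j) => /= h /(_ _); try move=> /(_ isT); lra.
Qed.

(** Exactly the ordered pairs meeting [w] are lost. No pair is counted for both of its entries,
    since [w] has no loop. *)
Lemma qform_delete (R : realType) (n : nat) (S : {set 'I_n}) (e : rel 'I_n)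
    (x : 'I_n -> R) (w : 'I_n) :
  (forall i j, e i j = e j i) -> ~~ e w w ->
  qform (restr (S :\ w) e) (fun i => if i == w then 0 else x i) =
  qform (restr S e) x - 2 * \sum_j (restr S e w j)%:R * (x w + x j) ^+ 2.
Proof.
move=> sym irr.
have -> : 2 * \sum_j (restr S e w j)%:R * (x w + x j) ^+ 2 =
  \sum_i \sum_j ((i == w)%:R + (j == w)%:R) * ((restr S e i j)%:R * (x i + x j) ^+ 2).
  under [RHS]eq_bigr do under eq_bigr do rewrite mulrDl.
  under [RHS]eq_bigr do rewrite big_split /=.
  rewrite big_split /= [X in _ + X]exchange_big /=.
  under [X in _ = X + _]eq_bigr do rewrite -big_distrr /=.
  under [X in _ = _ + X]eq_bigr do rewrite -big_distrr /=.
  rewrite !sum_delta mulr_natl mulr2n; congr (_ + _); apply: eq_bigr => j _.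
  by rewrite (restr_sym _ sym) addrC.
rewrite /qform -sumrB; apply: eq_bigr => i _; rewrite -sumrB.
apply: eq_bigr => j _; rewrite /restr !in_setD1.
case: (eqVneq i w) => [->|iw] /=; case: (eqVneq j w) => [->|jw] /=;
  rewrite ?(negPf irr) ?andbF /=; ring.
Qed.

(** The conclusion says that the ratio of [q] to the number of vertices grows by more than [eps / 8]
    over [#|S|]. The vertex [w] is one of smallest entry; the low degree of [u] forces that entry to
    be small, and the eigenvector with entry [w] set to 0 is a test vector for the smaller graph. *)
Lemma delete_vertex (R : realType) (n : nat) (S : {set 'I_n}) (e : rel 'I_n)
    (u : 'I_n) (eps : R) :
  simple_graph e -> u \in S -> 0 < eps <= 2^-1 -> 16 < eps * #|S|%:R ->
  5 / 4 * #|S|%:R <= q R (restr S e) ->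
  (deg (restr S e) u)%:R <= q R (restr S e) / 2 - eps * #|S|%:R ->
  exists2 w, w \in S &
    (q R (restr S e) + eps / 8) * (#|S|%:R - 1) < q R (restr (S :\ w) e) * #|S|%:R.
Proof.
move=> [sym irr] uS /andP[e0 e1] m16 q54 du.
have n0 : (0 < n)%N by case: (n) u {uS du} => [[]|].
have symS := @restr_sym _ S e sym.
have [_ [x [x0 x1 xq]]] := q_spec R n0 symS.
have [w wS wmin] := @arg_minP _ R _ u (fun i => i \in S) x uS.
exists w => //.
have [rayl _] := q_spec R n0 (@restr_sym _ (S :\ w) e sym).
have q2m := q_le_card R S n0 sym.
move: q2m q54 du xq.
set Q := q R (restr S e); set Q' := q R _ in rayl *; set m : R := #|S|%:R.
rewrite -/m in m16.
set d : R := (deg _ u)%:R => q2m q54 du xq.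
have d_ge0 : 0 <= d by rewrite ler0n.
have dm : d <= m by rewrite ler_nat deg_restr_le.
have m0 : 0 < m by nra.
set y := x w ^+ 2; have y0 : 0 <= y by apply: sqr_ge0.
have ymin j : j \in S -> y <= x j ^+ 2.
  by move=> jS; rewrite ler_sqr ?nnegrE //; apply: wmin.
(* The neighbours of [u] have entries summing to [(Q - d) * x u], so by Cauchy-Schwarz they carry
   much mass, while the remaining [m - d] vertices have mass at least [y] each; the total is 1. *)
have ybound : y * ((Q - d) ^+ 2 + d * (m - d)) <= d.
  have := nbr_mass_le e u ymin; rewrite x1 -/d -/m.
  have := weighted_cauchy (restr S e u) x; rewrite sum_adj -/d.
  set s := \sum_j _ * x j ^+ 2; set A := \sum_j _ => cauchy mass.
  have Au : A = (Q - d) * x u.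
    have := xq u; under eq_bigr do rewrite mulrDr.
    by rewrite big_split /= -big_distrl /= sum_adj -/d -/A; lra.
  have h1 : (Q - d) ^+ 2 * y <= d * s.
    apply: le_trans cauchy; rewrite Au exprMn; apply: ler_wpM2l (ymin u uS).
    exact: sqr_ge0.
  have h2 : d * (s + (m - d) * y) <= d * 1 by apply: ler_wpM2l.
  by lra.
have ybig : m * y * (1 + 2 * eps) <= 1.
  have h : m * (1 + 2 * eps) * d <= (Q - d) ^+ 2 + d * (m - d).
    (* After cancellation the claim is [2 * eps * m * d <= 2 * Q * (Q / 2 - d)], which follows from
       [eps * m <= Q / 2 - d] and [d <= m <= Q]. *)
    have h1 : eps * m * d <= eps * m * m by rewrite ler_pM2l ?mulr_gt0.
    have h2 : eps * m * m <= Q * (eps * m) by rewrite mulrC; apply: ler_wpM2r; nra.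
    have h3 : 0 <= Q * (Q / 2 - eps * m - d) by apply: mulr_ge0; lra.
    by lra.
  have h' := ler_wpM2l y0 h.
  have [d_eq0|d_neq0] := eqVneq d 0; last first.
    have d_gt0 : 0 < d by rewrite lt_neqAle eq_sym d_neq0.
    by rewrite -(ler_pM2r d_gt0); lra.
  have : y * Q ^+ 2 <= 0 by move: ybound; rewrite d_eq0; lra.
  have Q2 : 0 < Q ^+ 2 by apply: exprn_gt0; lra.
  rewrite pmulr_lle0 // => yle.
  have -> : y = 0 by apply/eqP; rewrite eq_le yle.
  by rewrite mulr0 mul0r.
have gap : eps <= 1 - m * y.
  by nra.
have loss : \sum_j (restr S e w j)%:R * (x w + x j) ^+ 2 <= 1 + (2 * Q - m) * y.
  have := nbr_mass_le e w ymin; rewrite x1 -/m.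
  have := xq w; under eq_bigr do rewrite mulrDr.
  rewrite big_split /= -big_distrl /= sum_adj.
  set dw : R := (deg _ w)%:R; set A := \sum_j _; set s := \sum_j _ * x j ^+ 2.
  move=> eqA mass.
  have -> : \sum_j (restr S e w j)%:R * (x w + x j) ^+ 2 = dw * y + 2 * x w * A + s.
    rewrite /dw -sum_adj big_distrl [2 * _ * _]big_distrr -!big_split /=.
    by apply: eq_bigr => j _; rewrite /y; ring.
  have -> : A = (Q - dw) * x w by lra.
  have -> : dw * y + 2 * x w * ((Q - dw) * x w) = (2 * Q - dw) * y by rewrite /y; ring.
  by lra.
have Q'y : Q - (1 + (2 * Q - m) * y) <= Q' * (1 - y).
  have := rayl (fun i => if i == w then 0 else x i).
  have irrw := irr w; rewrite qform_delete //.
  rewrite (qform_eigenvector symS xq) x1.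
  have -> : \sum_i (if i == w then 0 else x i) ^+ 2 = 1 - y.
    rewrite -x1 (bigD1 w) //= [in RHS](bigD1 w) //= eqxx expr0n /= add0r -/y [in RHS]addrAC subrr add0r.
    by apply: eq_bigr => i /negPf ->.
  by lra.
(* Combining [small] and [Q'y] gives [(Q - m) * (1 - m * y) <= Q * y + eps / 8 * (m - 1) * (1 - y)].
   The left side is at least [eps * m / 4] and the right side at most about [2 + eps * m / 8], which
   contradicts [16 < eps * m]. *)
rewrite ltNge; apply/negP => small.
have y1 : 0 <= 1 - y by nra.
have h1 := ler_wpM2r y1 small.
have h2 := ler_wpM2l (ltW m0) Q'y.
have h3 : (Q - m) * eps <= (Q - m) * (1 - m * y) by apply: ler_wpM2l => //; lra.
have h4 : m / 4 * eps <= (Q - m) * eps by rewrite ler_pM2r //; lra.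
have h5 : Q * y <= 2 * m * y by apply: ler_wpM2r.
have h6 : 0 <= eps * y * (m - 1) by rewrite !mulr_ge0 ?(ltW e0) //; nra.
have h7 : 0 <= m * y by rewrite mulr_ge0 // ltW.
by lra.
Qed.

(** * Counting cliques *)

Lemma cliqueP (n : nat) (e : rel 'I_n) (T : {set 'I_n}) :
  reflect {in T &, forall i j, i != j -> e i j} (clique e T).
Proof.
apply: (iffP forall_inP) => [h i j iT jT ij|h i iT].
  by have /forall_inP/(_ j jT)/implyP/(_ ij) := h i iT.
by apply/forall_inP => j jT; apply/implyP; exact: h.
Qed.

Definition ncliques (n : nat) (e : rel 'I_n) (j : nat) (P : {set 'I_n}) : nat :=
  #|[set T : {set 'I_n} | [&& T \subset P, #|T| == j & clique e T]]|.

Lemma clique_add (n : nat) (e : rel 'I_n) (v : 'I_n) (T : {set 'I_n}) :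
  (forall i j, e i j = e j i) -> {in T, forall j, e v j} -> clique e T ->
  clique e (v |: T).
Proof.
move=> sym vT /cliqueP cT; apply/cliqueP => i j /setU1P[->|iT] /setU1P[->|jT].
- by rewrite eqxx.
- by move=> _; exact: vT.
- by move=> _; rewrite sym; exact: vT.
- exact: cT.
Qed.

(** Double counting of pairs of a clique with [j.+1] vertices and one of its vertices [v]: removing
    [v] leaves a clique in the neighbourhood of [v]. *)
Lemma ncliques_step (n : nat) (e : rel 'I_n) (j : nat) (P : {set 'I_n}) :
  simple_graph e ->
  (\sum_(v in P) ncliques e j (P :&: [set w | e v w]) <= j.+1 * ncliques e j.+1 P)%N.
Proof.
move=> [sym irr]; set C := [set T : {set 'I_n} | [&& T \subset P, #|T| == j.+1 & clique e T]].
have -> : (j.+1 * ncliques e j.+1 P = \sum_(v : 'I_n) #|[set T in C | v \in T]|)%N.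
  transitivity (\sum_(T in C) #|T|)%N.
    rewrite mulnC -sum_nat_const; apply: eq_bigr => T.
    by rewrite inE => /and3P[_ /eqP -> _].
  under eq_bigr do rewrite -sum1_card big_mkcond.
  rewrite exchange_big; apply: eq_bigr => v _ /=.
  by rewrite -big_mkcondr -sum1_card; apply: eq_bigl => T; rewrite [in RHS]inE.
rewrite [leqRHS](bigID (mem P)) /=; apply: leq_trans (leq_addr _ _).
apply: leq_sum => v vP; rewrite /ncliques.
set C' := [set T : {set 'I_n} | _].
have nv (T : {set 'I_n}) : T \in C' -> v \notin T.
  rewrite inE subsetI => /andP[/andP[_ /subsetP TN] _]; apply/negP => /TN.
  by rewrite inE (negPf (irr v)).
rewrite -(@card_in_imset _ _ (fun T : {set 'I_n} => v |: T)) => [|T T' TC T'C eT].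
  apply/subset_leq_card/subsetP => _ /imsetP[T TC ->].
  have vT := nv _ TC; move: TC; rewrite !inE subsetI eqxx /= => /and3P[/andP[TP TN] /eqP cT clT].
  rewrite subUset sub1set vP TP cardsU1 vT cT eqxx andbT /=.
  by apply: clique_add => // w /(subsetP TN); rewrite inE.
by rewrite -(setU1K (nv _ TC)) eT setU1K ?nv.
Qed.

(** Choose the vertices one at a time. Each choice discards at most [D] candidates, so at least [t]
    remain for every one of the [j] choices, and a clique arises from [j]! orderings. *)
Lemma ncliques_greedy (R : realType) (n : nat) (e : rel 'I_n) (S : {set 'I_n}) (D t : R) :
  simple_graph e -> 0 <= t -> 0 <= D ->
  (forall v, v \in S -> #|S :\: [set w | e v w]|%:R <= D) ->
  forall (j : nat) (P : {set 'I_n}), P \subset S ->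
    ((0 < j)%N -> t + j.-1%:R * D <= #|P|%:R) ->
    t ^+ j <= (j`! * ncliques e j P)%:R.
Proof.
move=> sg t0 D0 hD; elim=> [|j IH] P PS hP.
  rewrite expr0 fact0 mul1n ler1n /ncliques card_gt0; apply/set0Pn; exists set0.
  by rewrite inE sub0set cards0 eqxx /=; apply/cliqueP => i k0; rewrite inE.
have {}hP := hP isT; rewrite /= in hP.
have step : #|P|%:R * t ^+ j <= \sum_(v in P) (j`! * ncliques e j (P :&: [set w | e v w]))%:R.
  rewrite mulr_natl -sumr_const; apply: ler_sum => v vP.
  apply: IH => [|j0]; first by apply: subset_trans PS; exact: subsetIl.
  have := hD v (subsetP PS v vP).
  have : (#|P| <= #|P :&: [set w | e v w]| + #|S :\: [set w | e v w]|)%N.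
    rewrite -(cardsID [set w | e v w] P) leq_add2l subset_leq_card //.
    exact: setSD.
  rewrite -(ler_nat R) natrD => h1 h2; move: hP.
  by rewrite -{1}(prednK j0) -natr1 mulrDl mul1r; lra.
have DP : t <= #|P|%:R by have := mulr_ge0 (ler0n R j) D0; lra.
rewrite exprS; apply: (@le_trans _ _ (#|P|%:R * t ^+ j)); first by rewrite ler_wpM2r ?exprn_ge0.
apply: le_trans step _; rewrite -natr_sum ler_nat -big_distrr /= factS.
rewrite (mulnC j.+1) -mulnA leq_mul2l; apply/orP; right; exact: ncliques_step.
Qed.

(** Adding both ends of the edge to a clique in their common neighbourhood is injective and gives a
    clique through that edge. *)
Lemma ncliques_nbrs_le_js (n k : nat) (e : rel 'I_n) (x y : 'I_n) :
  simple_graph e -> e x y ->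
  (ncliques e k ([set w | e x w] :&: [set w | e y w]) <= js k.+2 e)%N.
Proof.
move=> [sym irr] exy.
apply: (@leq_trans (nKr_through k.+2 e x y)); last first.
  by rewrite /js (bigD1 (x, y)) //= leq_maxl.
have xy : x != y by apply: contraTneq exy => ->; exact: irr.
rewrite /ncliques; set C' := [set T : {set 'I_n} | _].
have nT (T : {set 'I_n}) : T \in C' -> (y \notin T) * (x \notin y |: T).
  rewrite inE subsetI => /andP[/andP[/subsetP Tx /subsetP Ty] _].
  have yT : y \notin T by apply/negP => /Ty; rewrite inE (negPf (irr y)).
  by split=> //; rewrite !inE negb_or xy; apply/negP => /Tx; rewrite inE (negPf (irr x)).
rewrite -(@card_in_imset _ _ (fun T : {set 'I_n} => x |: (y |: T))) => [|T T' TC T'C eT].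
  apply/subset_leq_card/subsetP => _ /imsetP[T TC ->].
  have [yT xT] := nT _ TC; move: TC; rewrite !inE subsetI => /and3P[/andP[/subsetP Tx /subsetP Ty] /eqP cT clT].
  rewrite !eqxx orbT /= cardsU1 xT cardsU1 yT cT eqxx /=.
  apply: clique_add => // [w|].
    by case/setU1P => [->//|/Tx]; rewrite inE.
  by apply: clique_add => // w /Ty; rewrite inE.
by rewrite -(setU1K (nT _ TC).1) -(setU1K (nT _ TC).2) eT !setU1K ?(nT _ T'C).
Qed.

(** * Dense graphs with small joints are multipartite *)

Lemma card_cover_le (T I : finType) (X Z : {set T}) (K : {set I}) (A : I -> {set T}) :
  (forall w, w \in X -> w \notin Z -> exists2 u, u \in K & w \in A u) ->
  (#|X| <= #|Z| + \sum_(u in K) #|A u|)%N.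
Proof.
move=> h; have h1 : (#|\bigcup_(u in K) A u| <= \sum_(u in K) #|A u|)%N.
  elim/big_rec2: _ => [|u a s _ IH]; first by rewrite cards0.
  by apply: leq_trans (leq_card_setU _ _) _; rewrite leq_add2l.
apply: leq_trans (leq_add (leqnn _) h1); apply: leq_trans (leq_card_setU _ _).
apply/subset_leq_card/subsetP => w wX; rewrite inE.
by case: (boolP (w \in Z)) => //= wZ; apply/bigcupP; exact: h.
Qed.

(* A point lying in c >= 1 of the sets satisfies 2c <= 1 + c^2. *)
Lemma bonferroni (T I : finType) (S : {set T}) (K : {set I}) (A : I -> {set T}) :
  (forall u, u \in K -> A u \subset S) ->
  (2 * \sum_(u in K) #|A u| + #|S :\: \bigcup_(u in K) A u|
    <= #|S| + \sum_(u in K) \sum_(u' in K) #|A u :&: A u'|)%N.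
Proof.
move=> AS; have cardE (X : {set T}) : #|X| = (\sum_w (w \in X))%N.
  by rewrite -sum1_card big_mkcond; apply: eq_bigr => w _; case: (w \in X).
have -> : (\sum_(u in K) #|A u| = \sum_w \sum_(u in K) (w \in A u))%N.
  by rewrite [RHS]exchange_big; apply: eq_bigr => u _; exact: cardE.
have -> : (\sum_(u in K) \sum_(u' in K) #|A u :&: A u'| =
  \sum_w (\sum_(u in K) (w \in A u)) * (\sum_(u in K) (w \in A u)))%N.
  under [RHS]eq_bigr do rewrite big_distrl.
  rewrite [RHS]exchange_big; apply: eq_bigr => u _ /=.
  under [RHS]eq_bigr do rewrite big_distrr.
  rewrite [RHS]exchange_big; apply: eq_bigr => u' _ /=; rewrite cardE.
  by apply: eq_bigr => w _; rewrite inE mulnb.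
rewrite !cardE big_distrr -!big_split /=; apply: leq_sum => w _.
set c := (\sum_(u in K) _)%N.
have [c0|/negbTE c0] := boolP (w \in \bigcup_(u in K) A u); last first.
  have -> : c = 0%N.
    rewrite /c big1 // => u uK; apply/eqP; rewrite eqb0; apply/negP => wA.
    by move/bigcupP: c0; apply; exists u.
  by rewrite inE c0 /= muln0 addn0 add0n.
have [u uK wu] := bigcupP c0; have c1 : (0 < c)%N by rewrite /c (bigD1 u) //= wu.
by rewrite inE c0 /= (subsetP (AS u uK) w wu) addn0; nia.
Qed.

(** With [B v] the non-neighbours of [v] in [S], smallness of [js] makes [B x] and [B y] almost
    disjoint for every edge [x y]. The sets [B u], for [u] in a [k]-clique [K], then almost
    partition [S]. A vertex is coloured by some [v] in [K] such that it misses all of [U v], the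
    common neighbourhood of the other vertices of [K]. *)
Lemma multipartite_of_small_js (R : realType) (n k : nat) (e : rel 'I_n) (S : {set 'I_n})
    (eps : R) :
  simple_graph e -> (2 <= k)%N -> (0 < #|S|)%N -> 0 < eps ->
  5 * k%:R ^+ 4 * (k.+1%:R * eps) <= 1 ->
  (forall v, v \in S -> #|S :\: [set w | e v w]|%:R <= (k%:R^-1 + eps) * #|S|%:R) ->
  ((k - 1)`! * js k.+1 e)%:R < (eps * #|S|%:R) ^+ (k - 1) ->
  exists (K : {set 'I_n}) (f : 'I_n -> 'I_n), [/\ #|K| = k,
    forall v, v \in S -> f v \in K &
    forall u v, u \in S -> v \in S -> f u = f v -> ~~ e u v].
Proof.
move=> sg k2 S0 eps0 epsk hD hjs; have [sym irr] := sg.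
have ek : ((k - 1).+2 = k.+1)%N by lia.
set m : R := #|S|%:R in hD hjs *; set r : R := k%:R^-1 in hD *.
set D := (r + eps) * m in hD.
pose B v := S :\: [set w | e v w].
have BS v : B v \subset S by apply: subsetDl.
have inB v w : (w \in B v) = (w \in S) && ~~ e v w by rewrite !inE andbC.
have m0 : 0 < m by rewrite ltr0n.
have kk2 : 2 <= k%:R :> R by rewrite ler_nat.
have rk : r * k%:R = 1 by rewrite /r mulVf // pnatr_eq0; case: (k) k2.
have r0 : 0 < r by rewrite /r invr_gt0; lra.
set kk : R := k%:R in epsk kk2 rk *.
have kS : k.+1%:R = kk + 1 :> R by rewrite -natr1.
rewrite kS in epsk; pose dl := (kk + 1) * eps.
have dl0 : 0 < dl by rewrite /dl mulr_gt0 //; lra.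
have D0 : 0 <= D by rewrite /D mulr_ge0 //; lra.
have em0 : 0 <= eps * m by rewrite mulr_ge0 // ltW.
have epsdl : kk * eps <= dl by rewrite /dl; lra.
(* The polynomial collects all error terms in the bound on [#|B w|] that ends the proof of
   [colour]. *)
have dlk : dl * (kk ^+ 3 + 3 * kk ^+ 2 + 2 * kk + 1) < r.
  have h : dl * kk * 5 * kk ^+ 3 <= 1.
    by apply: le_trans epsk; rewrite /dl le_eqVlt; apply/orP; left; apply/eqP; ring.
  have h2 : kk ^+ 3 + 3 * kk ^+ 2 + 2 * kk + 1 < 5 * kk ^+ 3.
    have : 2 * kk ^+ 2 <= kk ^+ 3 by rewrite (exprS kk 2) ler_wpM2r ?sqr_ge0.
    have : 2 * kk <= kk ^+ 2 by rewrite expr2 ler_wpM2r //; lra.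
    by lra.
  have h3 : dl * (kk ^+ 3 + 3 * kk ^+ 2 + 2 * kk + 1) < dl * (5 * kk ^+ 3) by rewrite ltr_pM2l.
  apply: lt_le_trans h3 _; rewrite -(ler_pM2r (_ : 0 < kk)); last by lra.
  by rewrite rk; lra.
have kdl : kk * dl < r.
  apply: le_lt_trans dlk; rewrite mulrC ler_pM2l //.
  have : 0 <= kk ^+ 3 by apply: exprn_ge0; lra.
  have : 0 <= kk ^+ 2 by apply: exprn_ge0; lra.
  by lra.
have edge x y : x \in S -> y \in S -> e x y ->
    #|B x :&: B y|%:R <= dl * m /\ (r - dl) * m <= #|B x|%:R.
  move=> xS yS exy.
  pose P := S :&: ([set w | e x w] :&: [set w | e y w]).
  have cU : (#|B x :|: B y| + #|P| = #|S|)%N.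
    by rewrite /B -setDIr -(cardsID ([set w | e x w] :&: [set w | e y w]) S) addnC.
  have cUI := cardsUI (B x) (B y).
  move: cU cUI => /(congr1 (fun a => a%:R : R)) + /(congr1 (fun a => a%:R : R)).
  rewrite !natrD -/m => cU cUI.
  have hx := hD _ xS; have hy := hD _ yS; rewrite -/(B x) in hx; rewrite -/(B y) in hy.
  (* Otherwise greedy extension inside the common neighbourhood [P] yields too many cliques of size
     [k - 1], each completed by [x] and [y] to a clique of size [k.+1]. *)
  have Psmall : #|P|%:R < eps * m + (k - 1).-1%:R * D.
    rewrite ltNge; apply/negP => hP.
    have := ncliques_greedy sg em0 D0 hD (subsetIl _ _ : P \subset S) (fun=> hP).
    apply/negP; rewrite -ltNge; apply: le_lt_trans hjs; rewrite ler_nat leq_mul2l.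
    apply/orP; right; rewrite -ek.
    apply: leq_trans (ncliques_nbrs_le_js (k - 1) sg exy).
    apply/subset_leq_card/subsetP => T; rewrite !inE => /andP[TP ->]; rewrite andbT.
    by apply: subset_trans TP _; apply: subsetIr.
  have e2 : (k - 1).-1%:R = kk - 2 :> R by rewrite -subn1 -subnDA natrB.
  rewrite e2 in Psmall.
  have kD : kk * D = m + kk * eps * m by rewrite /D mulrDl mulrDr mulrA (mulrC kk r) rk; ring.
  have rD : D = r * m + eps * m by rewrite /D mulrDl.
  rewrite /dl; split; first by lra.
  by have := ler0n R #|B x :&: B y|; lra.
have nbr x : x \in S -> exists2 y, y \in S & e x y.
  move=> xS; have := hD x xS; rewrite -/(B x) => hx.
  have /subsetPn[y yS] : ~~ (S \subset B x).
    apply/negP => /subset_leq_card; rewrite -(ler_nat R) -/m => h.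
    have : D < m.
      rewrite /D -[ltRHS]mul1r ltr_pM2r // -rk.
      have : r * 2 <= r * kk by rewrite ler_pM2l.
      have : 2 * eps <= kk * eps by rewrite ler_pM2r.
      have : 2 * dl <= kk * dl by rewrite ler_pM2r.
      lra.
    by lra.
  by rewrite inB yS /= negbK => exy; exists y.
have Blow x : x \in S -> (r - dl) * m <= #|B x|%:R.
  by move=> xS; have [y yS exy] := nbr x xS; have [] := edge x y xS yS exy.
(* In the Bonferroni bound the diagonal terms return one copy of the sum of the [#|B u|], and the at
   most [kk ^+ 2] others cost [dl * m] each. The remaining copy is at least [m - kk * dl * m]. *)
have cover (K : {set 'I_n}) : K \subset S -> #|K| = k -> clique e K ->
    #|S :\: \bigcup_(u in K) B u|%:R <= (kk ^+ 2 + kk) * dl * m.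
  move=> /subsetP KS cK /cliqueP clK.
  have := @bonferroni _ _ S K B (fun u _ => BS u).
  rewrite -(ler_nat R) natrD natrM natrD -/m !natr_sum.
  have h1 : \sum_(u in K) (\sum_(u' in K) #|B u :&: B u'|)%:R <=
            \sum_(u in K) #|B u|%:R + kk * (kk * (dl * m)) :> R.
    have -> : kk * (kk * (dl * m)) = \sum_(u in K) (kk * (dl * m)).
      by rewrite sumr_const cK mulr_natl.
    rewrite -big_split /=; apply: ler_sum => u uK.
    rewrite (bigD1 u) //= setIid natrD lerD2l natr_sum.
    apply: (@le_trans _ _ (\sum_(u' in K) (dl * m))); last by rewrite sumr_const cK mulr_natl.
    rewrite [leRHS](bigD1 u) //= -[leLHS]add0r lerD //; first by rewrite mulr_ge0 ?ltW.
    apply: ler_sum => v /andP[vK vu].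
    by have [] := edge u v (KS _ uK) (KS _ vK) (clK _ _ uK vK _) => //; rewrite eq_sym.
  have h2 : kk * ((r - dl) * m) <= \sum_(u in K) #|B u|%:R.
    rewrite [kk * _]mulr_natl -cK -sumr_const; apply: ler_sum => u uK.
    by apply: Blow; apply: KS.
  have h3 : kk * ((r - dl) * m) = m - kk * dl * m by rewrite mulrA mulrBr (mulrC kk r) rk; ring.
  by lra.
have [K [KS cK clK]] : exists K : {set 'I_n}, [/\ K \subset S, #|K| = k & clique e K].
  have hP : eps * m + k.-1%:R * D <= #|S|%:R.
    have -> : k.-1%:R = kk - 1 :> R by rewrite -subn1 natrB // ltnW.
    have kD : kk * D = m + kk * eps * m by rewrite /D mulrDl mulrDr mulrA (mulrC kk r) rk; ring.
    rewrite -/m mulrBl mul1r kD {1}/D.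
    have : 0 <= (r - kk * eps) * m by rewrite mulr_ge0 ?(ltW m0) // subr_ge0; nra.
    lra.
  have := ncliques_greedy sg em0 D0 hD (subxx S) (fun=> hP).
  have : 0 < (eps * m) ^+ k by rewrite exprn_gt0 // mulr_gt0.
  move=> h /(lt_le_trans h); rewrite ltr0n muln_gt0 => /andP[_].
  rewrite card_gt0 => /set0Pn[K]; rewrite inE => /and3P[KS /eqP cK clK].
  by exists K.
have /subsetP KS' := KS; have /cliqueP clK' := clK.
pose U v := S :\: \bigcup_(u in K :\ v) B u.
have inU v z u : z \in U v -> u \in K -> u != v -> e u z.
  rewrite inE => /andP[zn zS] uK uv; rewrite -[e u z]negbK; apply/negP => h.
  by case/negP: zn; apply/bigcupP; exists u; rewrite ?inB ?zS // !inE uv.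
have US v : U v \subset S by apply: subsetDl.
have colour w : w \in S -> exists2 v, v \in K & forall z, z \in U v -> ~~ e w z.
  move=> wS; have [/exists_inP[v vK /forall_inP h]|] :=
    boolP [exists v in K, [forall z in U v, ~~ e w z]]; first by exists v.
  rewrite negb_exists_in => /forall_inP h; exfalso.
  (* Suppose [w] has a neighbour [z] in [U v]. Exchanging [v] for [z] gives another [k]-clique,
     whose sets also almost cover [S], so [B w :&: B v] is covered by a small remainder,
     [B w :&: B z] and the sets [B u :&: B v], all small. *)
  have {}h v : v \in K -> #|B w :&: B v|%:R <= (kk ^+ 2 + kk + 1 + kk) * dl * m.
    move=> vK; have := h v vK; rewrite negb_forall_in => /exists_inP[z zU].
    rewrite negbK => ewz; have zS := subsetP (US v) z zU.
    have zK : z \notin K :\ v.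
      apply/negP => zK; have := inU v z z zU; rewrite (negPf (irr z)).
      by move: zK; rewrite inE => /andP[zv zK] /(_ zK); rewrite inE in zv => /(_ zv).
    pose K' := z |: (K :\ v).
    have cov := cover K'.
    have {}cov : #|S :\: \bigcup_(u in K') B u|%:R <= (kk ^+ 2 + kk) * dl * m.
      apply: cov; first by rewrite subUset sub1set zS; apply: subset_trans KS; exact: subsetDl.
        by rewrite cardsU1 zK -cK (cardsD1 v K) vK.
      apply: clique_add => // [u|].
        by rewrite !inE => /andP[uv uK]; rewrite sym; exact: inU uv.
      apply/cliqueP => i j; rewrite !inE => /andP[_ iK] /andP[_ jK]; exact: clK'.
    have [wz _] := edge w z wS zS ewz.
    pose A u := if u == v then B w :&: B z else B u :&: B v.
    have : (#|B w :&: B v| <= #|S :\: \bigcup_(u in K') B u| + \sum_(u in K) #|A u|)%N.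
      apply: card_cover_le => y; rewrite inE => /andP[yw yv] yn.
      have yS := subsetP (BS _) y yv.
      move: yn; rewrite inE yS andbT negbK => /bigcupP[u /setU1P[->|/setD1P[uv uK]] yu].
        by exists v; rewrite // /A eqxx in_setI yw.
      by exists u; rewrite // /A (negPf uv) in_setI yu.
    rewrite -(ler_nat R) natrD natr_sum [\sum_(u in K) _](bigD1 v) //= {1}/A eqxx.
    have h1 : \sum_(u in K | u != v) #|A u|%:R <= kk * (dl * m).
      apply: (@le_trans _ _ (\sum_(u in K) (dl * m))); last by rewrite sumr_const cK mulr_natl.
      rewrite [leRHS](bigD1 v) //= -[leLHS]add0r lerD //; first by rewrite mulr_ge0 ?ltW.
      apply: ler_sum => u /andP[uK uv]; rewrite /A (negPf uv).
      by have [] := edge u v (KS' _ uK) (KS' _ vK) (clK' _ _ uK vK uv).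
    by lra.
  (* The sets [B v] almost cover [S] and each meets [B w] in little, so [B w] would be smaller than
     [Blow] allows. *)
  have : (#|B w| <= #|S :\: \bigcup_(u in K) B u| + \sum_(u in K) #|B w :&: B u|)%N.
    apply: card_cover_le => y yw; have yS := subsetP (BS _) y yw.
    rewrite inE yS andbT negbK => /bigcupP[u uK yu].
    by exists u; rewrite // in_setI yw.
  rewrite -(ler_nat R) natrD natr_sum => hB.
  have h1 : \sum_(u in K) #|B w :&: B u|%:R <= kk * ((kk ^+ 2 + kk + 1 + kk) * dl * m).
    by rewrite [leRHS]mulr_natl -cK -sumr_const; apply: ler_sum => u; exact: h.
  have := Blow w wS; have := cover K KS cK clK.
  have := dlk; rewrite -(ltr_pM2r m0).
  lra.
(* The default value [w] is never taken on [S], by [colour]. *)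
pose f w := odflt w [pick v in K | [forall z in U v, ~~ e w z]].
have fP w : w \in S -> f w \in K /\ forall z, z \in U (f w) -> ~~ e w z.
  move=> wS; rewrite /f; case: pickP => [v /andP[vK /forall_inP h]|h] //=.
  have [v vK hv] := colour w wS.
  by have := h v; rewrite vK /= => /negP; case; apply/forall_inP.
exists K, f; split=> // [v vS|u v uS vS fuv]; first by have [] := fP v vS.
apply/negP => euv; have [fK hu] := fP u uS; have [_] := fP v vS; rewrite -fuv => hv.
have [h1 _] := edge u v uS vS euv.
(* Adjacent vertices of the same colour both miss [U (f u)]. This set has size about [r * m], but
   would lie in the small intersection of [B u] and [B v]. *)
have h2 : (#|U (f u)| <= #|B u :&: B v|)%N.
  apply/subset_leq_card/subsetP => z zU; have zS := subsetP (US _) z zU.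
  by rewrite inE !inB zS /= hu ?hv.
have h3 : (#|S| <= #|U (f u)| + \sum_(w in K :\ f u) #|B w|)%N.
  apply: card_cover_le => y yS; rewrite inE yS andbT negbK => /bigcupP[w wK yw].
  by exists w.
have h4 : \sum_(w in K :\ f u) #|B w|%:R <= (kk - 1) * D.
  have -> : kk - 1 = #|K :\ f u|%:R.
    by rewrite /kk -cK (cardsD1 (f u) K) fK natrD addrC addKr.
  rewrite mulr_natl -sumr_const; apply: ler_sum => w; rewrite !inE => /andP[_ wK].
  by apply: hD; apply: KS'.
move: h2 h3; rewrite -!(ler_nat R) natrD natr_sum -/m => h2 h3.
have kD : kk * D = m + kk * eps * m by rewrite /D mulrDl mulrDr mulrA (mulrC kk r) rk; ring.
have rD : D = r * m + eps * m by rewrite /D mulrDl.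
have h5 : kk * dl * m < r * m by rewrite ltr_pM2r.
have h6 : 2 * (dl * m) <= kk * (dl * m) by rewrite ler_pM2r // mulr_gt0.
have h7 : kk * eps * m <= dl * m by rewrite ler_pM2r.
have h8 : 0 <= dl * m by rewrite mulr_ge0 ?ltW.
lra.
Qed.

(** * Multipartite graphs *)

Definition part_size (n k : nat) (S : {set 'I_n}) (c : 'I_n -> 'I_k) (i : 'I_k) : nat :=
  #|[set w in S | c w == i]|.

Lemma sum_part_size (n k : nat) (S : {set 'I_n}) (c : 'I_n -> 'I_k) :
  (\sum_i part_size S c i = #|S|)%N.
Proof.
rewrite -sum1_card (partition_big c predT) //=; apply: eq_bigr => i _.
by rewrite /part_size -sum1_card; apply: eq_bigl => w; rewrite inE.
Qed.

Lemma part_sizeE (R : realType) (n k : nat) (S : {set 'I_n}) (c : 'I_n -> 'I_k) (i : 'I_k) :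
  (part_size S c i)%:R = \sum_(w in S | c w == i) 1 :> R.
Proof.
by rewrite /part_size -sum1_card natr_sum; apply: eq_bigl => w; rewrite inE.
Qed.

(* [dev u] measures the edges missing at [u] for the graph to be complete multipartite. *)
Lemma part_identity (R : realType) (n k : nat) (S : {set 'I_n}) (e : rel 'I_n)
    (c : 'I_n -> 'I_k) :
  (0 < n)%N -> (forall i j, e i j = e j i) ->
  {in S &, forall u v, c u = c v -> ~~ e u v} ->
  #|S|%:R < q R (restr S e) ->
  exists (x dev : 'I_n -> R) (s : 'I_k -> R), [/\
    [/\ forall w, 0 <= x w, 0 < \sum_i s i &
      forall u, dev u = \sum_(v in S | (c v != c u) && ~~ e u v) (x u + x v)],
    forall u, u \in S -> q R (restr S e) * x u + dev u =
      (#|S|%:R - (part_size S c (c u))%:R) * x u + (\sum_i s i - s (c u)) &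
    forall i, (q R (restr S e) - #|S|%:R + 2 * (part_size S c i)%:R) * s i
      + \sum_(u in S | c u == i) dev u = (part_size S c i)%:R * \sum_i s i].
Proof.
move=> n0 sym proper qm; have q0 : 0 < q R (restr S e) by apply: le_lt_trans qm.
have [_ [x [x0 x1 xq]]] := q_spec R n0 (@restr_sym _ S e sym).
set Q := q R _ in qm q0 xq *; set m : R := #|S|%:R in qm *.
(* Such [w] is isolated in [restr S e] and [q] is positive, so the entry vanishes. *)
have xS w : w \notin S -> x w = 0.
  move=> wS; have := xq w; rewrite big1 => [/eqP|j _].
    by rewrite mulf_eq0 gt_eqF //= => /eqP.
  by rewrite /restr (negPf wS) mul0r.
pose s i := \sum_(w in S | c w == i) x w.
pose dev u := \sum_(v in S | (c v != c u) && ~~ e u v) (x u + x v).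
have sT : \sum_i s i = \sum_(w in S) x w by rewrite (partition_big c predT).
have eqn u : u \in S -> Q * x u + dev u =
    (m - (part_size S c (c u))%:R) * x u + (\sum_i s i - s (c u)).
  move=> uS; rewrite xq.
  have -> : \sum_j (restr S e u j)%:R * (x u + x j) =
            \sum_(v in S | (c v != c u) && e u v) (x u + x v).
    rewrite [RHS]big_mkcond; apply: eq_bigr => j _; rewrite /restr uS /=.
    case: (boolP (j \in S)) => jS; last by rewrite mul0r.
    case: eqP => [cj|cj] /=; last by case: (e u j); rewrite ?mul1r ?mul0r.
    by rewrite (negPf (proper u j uS jS (esym cj))) mul0r.
  have -> : \sum_(v in S | (c v != c u) && e u v) (x u + x v) + dev u =
            \sum_(v in S | c v != c u) (x u + x v).
    rewrite [RHS](bigID (e u)) /=; congr (_ + _); apply: eq_bigl => v; by rewrite andbA.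
  have h : \sum_(v in S) (x u + x v) = m * x u + \sum_i s i.
    by rewrite big_split /= sumr_const mulr_natl sT.
  have : \sum_(v in S | c v == c u) (x u + x v) + \sum_(v in S | c v != c u) (x u + x v) =
         \sum_(v in S) (x u + x v) by rewrite [RHS](bigID (fun v => c v == c u)).
  rewrite h big_split /= -/(s (c u)).
  have -> : \sum_(v in S | c v == c u) x u = (part_size S c (c u))%:R * x u.
    by rewrite part_sizeE big_distrl; apply: eq_bigr => v _ /=; rewrite mul1r.
  by lra.
exists x, dev, s; split=> //.
- split=> //; rewrite sT lt_neqAle sumr_ge0 // andbT; apply/negP => /eqP/esym.
  move/eqP; rewrite psumr_eq0 // => /allP h.
  have xz w : x w = 0.
    have [wS|] := boolP (w \in S); last exact: xS.
    by apply/eqP; have := h w (mem_index_enum _); rewrite wS.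
  by move: x1; rewrite big1 => [/eqP|i _]; [rewrite eq_sym oner_eq0 | rewrite xz expr0n].
- move=> i; set N : R := (part_size S c i)%:R; set T := \sum_i s i.
  have : \sum_(u in S | c u == i) (Q * x u + dev u) =
         \sum_(u in S | c u == i) ((m - N) * x u + (T - s i)).
    by apply: eq_bigr => u /andP[uS /eqP cu]; rewrite eqn // cu.
  rewrite big_split [in RHS]big_split /= -!big_distrr /= -/(s i).
  have -> : \sum_(u in S | c u == i) (T - s i) = N * (T - s i).
    by rewrite /N part_sizeE big_distrl; apply: eq_bigr => v _ /=; rewrite mul1r.
  by move: (\sum_(u in S | _) dev u) => b; lra.
Qed.

(** Divide the identity for part [i] by [a + 2 * N i] and sum over the parts: the excess of the sum
    over 1 is, up to the positive factor [\sum_i s i], a weighted sum of the nonnegative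
    deviations. *)
Lemma part_sum_ge1 (R : realType) (n k : nat) (S : {set 'I_n}) (e : rel 'I_n)
    (c : 'I_n -> 'I_k) (a := q R (restr S e) - #|S|%:R) :
  (0 < n)%N -> (forall i j, e i j = e j i) ->
  {in S &, forall u v, c u = c v -> ~~ e u v} -> 0 < a ->
  1 <= \sum_i (part_size S c i)%:R / (a + 2 * (part_size S c i)%:R) /\
  (\sum_i (part_size S c i)%:R / (a + 2 * (part_size S c i)%:R) <= 1 <->
   {in S &, forall u v, c u != c v -> e u v}).
Proof.
move=> n0 sym proper a0.
have qm : #|S|%:R < q R (restr S e) by rewrite -subr_gt0.
have [x [dev [s [[x0 T0 devE] vert part]]]] := part_identity n0 sym proper qm.
set N := fun i => (part_size S c i)%:R : R.
have aN i : 0 < a + 2 * N i by rewrite ltr_wpDr // mulr_ge0.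
have dev0 u : 0 <= dev u by rewrite devE; apply: sumr_ge0 => v _; rewrite addr_ge0.
pose Dev i := \sum_(u in S | c u == i) dev u.
have Dev0 i : 0 <= Dev i by apply: sumr_ge0.
have sE i : N i / (a + 2 * N i) * (\sum_i s i) = s i + Dev i / (a + 2 * N i).
  have := part i; rewrite -/a -/(N i) -/(Dev i) => h.
  by rewrite mulrAC -h mulrDl mulrAC divff ?mul1r // gt_eqF.
have sumE : (\sum_i N i / (a + 2 * N i)) * (\sum_i s i) =
            \sum_i s i + \sum_i Dev i / (a + 2 * N i).
  by rewrite big_distrl -big_split /=; apply: eq_bigr => i _; exact: sE.
have sumDev0 : 0 <= \sum_i Dev i / (a + 2 * N i).
  by apply: sumr_ge0 => i _; rewrite divr_ge0 // ltW.
split; first by rewrite -(ler_pM2r T0) sumE mul1r lerDl.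
split=> [le1 u v uS vS cuv|full].
  have sum0 : \sum_i Dev i / (a + 2 * N i) = 0.
    apply/eqP; rewrite eq_le sumDev0 andbT.
    by move: le1; rewrite -(ler_pM2r T0) sumE mul1r gerDl.
  have DevZ i : Dev i = 0.
    move/eqP: sum0; rewrite psumr_eq0 => [/allP h|j _]; last by rewrite divr_ge0 // ltW.
    have := h i (mem_index_enum _); rewrite /= mulf_eq0 invr_eq0 (gt_eqF (aN i)) orbF.
    by move/eqP.
  have devZ w : w \in S -> dev w = 0.
    move=> wS; have /eqP := DevZ (c w); rewrite psumr_eq0 // => /allP h.
    by have := h w (mem_index_enum _); rewrite wS eqxx /= => /eqP.
  apply/negPn/negP => euv.
  (* A missing edge without deviation forces [x u = 0]. The equation at [u] then puts all the mass
     in the part of [u], so [N i / (a + 2 * N i) = 1] for that part, impossible as [a] is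
     positive. *)
  have xu : x u = 0.
    have /eqP := devZ u uS; rewrite devE psumr_eq0 => [/allP h|w _]; last by rewrite addr_ge0.
    have := h v (mem_index_enum _); rewrite vS eq_sym cuv euv /= paddr_eq0 //.
    by case/andP=> /eqP.
  have := vert u uS; rewrite xu devZ // !mulr0 !add0r => /esym/eqP.
  rewrite subr_eq0 => /eqP sT.
  have := sE (c u); rewrite DevZ mul0r addr0 -sT => /eqP.
  rewrite -subr_eq0 -[X in _ - X]mul1r -mulrBl mulf_eq0 (gt_eqF T0) orbF subr_eq0.
  rewrite eq_sym -(inj_eq (mulIf (lt0r_neq0 (aN (c u))))) mul1r mulfVK ?lt0r_neq0 //.
  by move/eqP; have := ler0n R (part_size S c (c u)); rewrite -/(N (c u)); lra.
have devZ u : u \in S -> dev u = 0.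
  move=> uS; rewrite devE big1 // => v /andP[vS /andP[cuv]].
  by rewrite full // eq_sym.
have DevZ i : Dev i = 0 by apply: big1 => u /andP[uS _]; apply: devZ.
rewrite -(ler_pM2r T0) sumE mul1r [X in _ + X]big1 ?addr0 // => i _.
by rewrite DevZ mul0r.
Qed.

Lemma q_multipartite_le (R : realType) (n k : nat) (S : {set 'I_n}) (e : rel 'I_n)
    (c : 'I_n -> 'I_k) :
  (0 < n)%N -> (2 <= k)%N -> (forall i j, e i j = e j i) ->
  {in S &, forall u v, c u = c v -> ~~ e u v} ->
  k%:R * q R (restr S e) <= 2 * (k%:R - 1) * #|S|%:R.
Proof.
move=> n0 k2 sym proper.
set Q := q R _; set m : R := #|S|%:R; set kk : R := k%:R.
have kk2 : 2 <= kk by rewrite ler_nat.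
have m0 : 0 <= m by rewrite ler0n.
have [Qm|Qm] := lerP Q m.
  have h1 : kk * Q <= kk * m by rewrite ler_pM2l //; lra.
  have h2 : 2 * m <= kk * m by rewrite ler_wpM2r.
  by lra.
pose a := Q - m; have a0 : 0 < a by rewrite subr_gt0.
have [ge1 _] := part_sum_ge1 n0 sym proper a0.
have sN : \sum_i (part_size S c i)%:R = m by rewrite -natr_sum sum_part_size.
(* [t / (a + 2 t)] is concave: compare with its tangent at [m / k]. *)
pose b := kk * a + 2 * m.
have b0 : 0 < b by rewrite /b ltr_wpDr ?mulr_ge0 // mulr_gt0 //; lra.
have tangent (t : R) : 0 <= t -> t / (a + 2 * t) <= m / b + kk ^+ 2 * a / b ^+ 2 * (t - m / kk).
  move=> t0; have at0 : 0 < a + 2 * t by lra.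
  rewrite -subr_ge0.
  have -> : m / b + kk ^+ 2 * a / b ^+ 2 * (t - m / kk) - t / (a + 2 * t) =
     2 * a * (kk * t - m) ^+ 2 / (b ^+ 2 * (a + 2 * t)).
    rewrite /b; field; rewrite -/b !gt_eqF //=; lra.
  by apply: divr_ge0; apply: mulr_ge0; rewrite ?sqr_ge0 //; lra.
have : \sum_i (part_size S c i)%:R / (a + 2 * (part_size S c i)%:R) <= kk * (m / b).
  apply: (@le_trans _ _ (\sum_(i < k) (m / b + kk ^+ 2 * a / b ^+ 2 *
     ((part_size S c i)%:R - m / kk)))).
    by apply: ler_sum => i _; apply: tangent.
  rewrite big_split /= sumr_const card_ord -[_ *+ k]mulr_natl -/kk gerDl.
  rewrite -big_distrr /= sumrB sN sumr_const card_ord -[m / kk *+ k]mulr_natl -/kk.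
  by rewrite mulrCA divff ?mulr1 ?subrr ?mulr0 // gt_eqF //; lra.
move/(le_trans ge1); rewrite mulrA ler_pdivlMr // mul1r /b /a; lra.
Qed.

(** For a fixed total, concavity makes the sum largest at balanced sizes, and raising [a] to [a']
    only lowers it. Both inequalities are squeezed between the two bounds by 1, so they are
    equalities. *)
Lemma part_sum_balanced (R : realType) (k p : nat) (a a' : R) (s t : 'I_k -> nat) :
  0 < a <= a' ->
  (\sum_i s i = \sum_i t i)%N -> (forall i, t i = p \/ t i = p.+1) ->
  \sum_i (t i)%:R / (a + 2 * (t i)%:R) <= 1 ->
  1 <= \sum_i (s i)%:R / (a' + 2 * (s i)%:R) ->
  (forall i, s i = p \/ s i = p.+1) /\
  \sum_i (s i)%:R / (a' + 2 * (s i)%:R) <= 1.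
Proof.
move=> /andP[a0 aa'] sumst tp tle1 sge1.
(* On integers [w] is nonnegative and vanishes only at [p] and [p.+1]; in [chord] it measures how
   far the concave function lies below its chord through these two points. *)
pose w (x : nat) : R := (x%:R - p%:R) * (x%:R - p%:R - 1).
have wp (x : nat) : x = p \/ x = p.+1 -> w x = 0.
  by rewrite /w => -[->|->]; rewrite ?subrr ?mul0r // -[p.+1%:R]natr1; ring.
have wlt (x : nat) : ~ (x = p \/ x = p.+1) -> 0 < w x.
  move=> h; have [xp|xp] : (x.+1 <= p)%N \/ (p.+2 <= x)%N by lia.
    by move: xp; rewrite /w -(ler_nat R) -natr1; nra.
  by move: xp; rewrite /w -(ler_nat R) -natr1 -[p.+1%:R]natr1; nra.
have w0 x : 0 <= w x.
  have [/wp ->//|/wlt/ltW //] : (x = p \/ x = p.+1) \/ ~ (x = p \/ x = p.+1) by lia.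
pose P : R := p%:R; have P0 : 0 <= P by rewrite ler0n.
pose c := 2 * a / ((a + 2 * P) * (a + 2 * (P + 1))).
have c0 : 0 < c by rewrite /c divr_gt0 ?mulr_gt0 //; lra.
pose al := P / (a + 2 * P); pose be := (P + 1) / (a + 2 * (P + 1)) - al.
have chord (x : nat) : x%:R / (a + 2 * x%:R) = al + be * (x%:R - P) - c * (w x / (a + 2 * x%:R)).
  rewrite /be /al /c /w -/P; have x0 := ler0n R x; field.
  by rewrite !gt_eqF //=; lra.
have sumE (f : 'I_k -> nat) : \sum_i (f i)%:R / (a + 2 * (f i)%:R) =
    k%:R * (al - be * P) + be * (\sum_i f i)%:R - c * \sum_i w (f i) / (a + 2 * (f i)%:R).
  have -> : k%:R * (al - be * P) = \sum_(i < k) (al - be * P).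
    by rewrite sumr_const card_ord mulr_natl.
  rewrite natr_sum !big_distrr -big_split -sumrB /=; apply: eq_bigr => i _.
  by rewrite chord; ring.
have le1 : \sum_i (s i)%:R / (a' + 2 * (s i)%:R) <= \sum_i (s i)%:R / (a + 2 * (s i)%:R).
  apply: ler_sum => i _; have := ler0n R (s i) => s0; rewrite ler_wpM2l // lef_pV2 ?posrE; lra.
have tE : \sum_i w (t i) / (a + 2 * (t i)%:R) = 0 by apply: big1 => i _; rewrite wp ?mul0r.
have tS := sumE t; have sS := sumE s; rewrite sumst in sS; rewrite tE mulr0 in tS.
have W0 i : 0 <= w (s i) / (a + 2 * (s i)%:R).
  by have := ler0n R (s i) => s0; rewrite divr_ge0 //; lra.
have cW : 0 <= c * \sum_i w (s i) / (a + 2 * (s i)%:R) by rewrite mulr_ge0 ?sumr_ge0 // ltW.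
split; last by lra.
have : c * \sum_i w (s i) / (a + 2 * (s i)%:R) == 0 by rewrite eq_le cW andbT; lra.
rewrite mulf_eq0 (gt_eqF c0) /= psumr_eq0 // => /allP h i.
have := h i (mem_index_enum _); rewrite /= mulf_eq0 invr_eq0.
have s0 := ler0n R (s i); rewrite [X in _ || X]gt_eqF ?orbF; last by lra.
move/eqP => wi; have [//|/wlt] : (s i = p \/ s i = p.+1) \/ ~ (s i = p \/ s i = p.+1) by lia.
by rewrite wi ltxx.
Qed.

Lemma restr_setT (n : nat) (e : rel 'I_n) : restr setT e = e.
Proof. by apply/funext => i; apply/funext => j; rewrite /restr !in_setT. Qed.

(** * The Turan graph *)

Definition residue (n k : nat) (k0 : (0 < k)%N) (w : 'I_n) : 'I_k :=
  Ordinal (ltn_pmod w k0).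

Lemma turanE (n k : nat) (k0 : (0 < k)%N) (u v : 'I_n) :
  turan n k u v = (residue k0 u != residue k0 v).
Proof. by []. Qed.

Lemma simple_turan (n k : nat) : simple_graph (turan n k).
Proof. by split=> [i j|i]; rewrite /turan ?eqxx // eq_sym. Qed.

Lemma turan_part_size (n k : nat) (k0 : (0 < k)%N) (i : 'I_k) :
  part_size setT (@residue n k k0) i = (n %/ k + (i < n %% k))%N.
Proof.
rewrite /part_size; have -> : (#|[set w in [set: 'I_n] | residue k0 w == i]| =
    \sum_(w < n) (w %% k == i))%N.
  rewrite -sum1_card big_mkcond; apply: eq_bigr => w _; rewrite !inE /=.
  by rewrite -val_eqE /=; case: (_ == _).
elim: n => [|n IH]; first by rewrite big_ord0 div0n mod0n.
rewrite big_ord_recr /= IH divnS // modnS; have := ltn_pmod n k0.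
have := ltn_ord i; have := divn_eq n k; case: (boolP (k %| n.+1)%N) => [/dvdnP[b hb]|_] //=.
  move=> nE ik mk; have : (n %% k).+1 = k.
    have : (k %| n.+1)%N by rewrite hb dvdn_mull.
    rewrite {1}nE -addnS dvdn_addr ?dvdn_mull // => /dvdn_leq; lia.
  lia.
by move=> _ _ _; lia.
Qed.

(** Equal fibre sizes mean that the two sequences of values agree as multisets. *)
Lemma fiber_perm (T : eqType) (n : nat) (c d : 'I_n -> T) :
  (forall x, #|[set i | c i == x]| = #|[set i | d i == x]|) ->
  exists f : {perm 'I_n}, forall i, c i = d (f i).
Proof.
move=> h; have /tuple_permP[f hf] : perm_eq [tuple c i | i < n] [tuple d i | i < n].
  apply/allP => x _ /=; apply/eqP; rewrite !count_map.
  have count_fiber (g : 'I_n -> T) : count (preim g (pred1 x)) (enum 'I_n) = #|[set i | g i == x]|.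
    by rewrite -sum1_count -sum1_card big_enum_cond; apply: eq_bigl => i; rewrite !inE.
  rewrite -!enumT; exact: etrans (count_fiber c) (etrans (h x) (esym (count_fiber d))).
exists f => i; have := congr1 (fun s => tnth s i) (val_inj hf).
by rewrite !tnth_mktuple.
Qed.

(** Both families of sizes take only two consecutive values and have total [n], so they have equally
    many large parts. A permutation of the colours matches the sizes, then one of the vertices
    matches the parts. *)
Lemma isomorphic_turan (n k : nat) (e : rel 'I_n) (c : 'I_n -> 'I_k) :
  (0 < k)%N -> (forall u v, e u v = (c u != c v)) ->
  (forall i, part_size setT c i = (n %/ k)%N \/ part_size setT c i = (n %/ k).+1) ->
  isomorphic e (turan n k).
Proof.
move=> k0 ec hs; pose s i := part_size setT c i; pose t i := part_size setT (@residue n k k0) i.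
have ht i : t i = (n %/ k)%N \/ t i = (n %/ k).+1.
  by rewrite /t turan_part_size; case: (_ < _)%N; rewrite ?addn1 ?addn0; [right|left].
have sumE (g : 'I_k -> nat) : (forall i, g i = (n %/ k)%N \/ g i = (n %/ k).+1) ->
    (\sum_i g i = k * (n %/ k) + #|[set i | g i == (n %/ k).+1]|)%N.
  move=> hg; rewrite -sum1_card [in RHS]big_mkcond /= -[k in (k * _)%N]card_ord -sum_nat_const.
  rewrite -big_split; apply: eq_bigr => i _ /=; rewrite inE.
  by have [->|->] := hg i; rewrite ?eqxx ?addn1 // ltn_eqF ?addn0.
have cardA : #|[set i | s i == (n %/ k).+1]| = #|[set i | t i == (n %/ k).+1]|.
  by apply/(@addnI (k * (n %/ k))%N); rewrite -!sumE // !sum_part_size.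
have [f hf] : exists f : {perm 'I_k}, forall i, s i = t (f i).
  apply: fiber_perm => x.
  have [->//|xp1] := eqVneq x (n %/ k).+1.
  have [xp|xp] := eqVneq x (n %/ k)%N; last first.
    have empty (g : 'I_k -> nat) : (forall i, g i = (n %/ k)%N \/ g i = (n %/ k).+1) ->
        [set i | g i == x] = set0.
      move=> hg; apply/setP => i; rewrite !inE; apply/negbTE.
      by have [->|->] := hg i; rewrite eq_sym.
    by rewrite (empty s hs) (empty t ht).
  have compl (g : 'I_k -> nat) : (forall i, g i = (n %/ k)%N \/ g i = (n %/ k).+1) ->
      [set i | g i == x] = ~: [set i | g i == (n %/ k).+1].
    move=> hg; apply/setP => i; rewrite !inE xp.
    by have [->|->] := hg i; rewrite ?eqxx ?[_.+1 == _]eq_sym ltn_eqF.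
  by rewrite (compl s hs) (compl t ht) cardsCs [RHS]cardsCs !setCK cardA.
have [g hg] : exists g : {perm 'I_n}, forall u, f (c u) = residue k0 (g u).
  apply: fiber_perm => i.
  have -> : [set u | f (c u) == i] = [set u in setT | c u == (f^-1)%g i].
    by apply/setP => u; rewrite !inE -[RHS](inj_eq (@perm_inj _ f)) permKV.
  have -> : [set u : 'I_n | residue k0 u == i] = [set u in setT | residue k0 u == i].
    by apply/setP => u; rewrite !inE.
  by have e1 : s ((f^-1)%g i) = t i; [rewrite hf permKV | exact: e1].
exists g => u v; rewrite ec turanE -!hg.
by rewrite (inj_eq (@perm_inj _ f)).
Qed.

(** Rayleigh bound with the all-ones vector. *)
Lemma q_turan_ge (R : realType) (n k : nat) : (0 < n)%N -> (0 < k)%N ->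
  2 * (n%:R ^+ 2 * (k%:R - 1) - k%:R ^+ 2) <= k%:R * (q R (turan n k) * n%:R).
Proof.
move=> n0 k0; pose p := (n %/ k)%N; pose t i := part_size setT (@residue n k k0) i.
have [sym _] := simple_turan n k.
have [rayl _] := q_spec R n0 sym.
have := rayl (fun=> 1); rewrite expr1n sumr_const card_ord.
have -> : qform (turan n k) (fun=> 1) = 4 * (n%:R ^+ 2 - \sum_i (t i)%:R ^+ 2) :> R.
  have sumT : \sum_(i < k) (t i)%:R = n%:R :> R.
    by rewrite -natr_sum sum_part_size cardsT card_ord.
  have row u : \sum_v (turan n k u v)%:R = n%:R - (t (residue k0 u))%:R :> R.
    have <- : \sum_(v < n) 1 = n%:R :> R by rewrite sumr_const card_ord.
    rewrite part_sizeE [X in _ - X]big_mkcond -sumrB; apply: eq_bigr => v _.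
    by rewrite turanE in_setT eq_sym /=; case: (_ == _); rewrite ?subrr ?subr0.
  transitivity (4 * \sum_(u < n) \sum_v (turan n k u v)%:R : R).
    rewrite big_distrr; apply: eq_bigr => u _; rewrite big_distrr.
    by apply: eq_bigr => v _ /=; ring.
  congr (_ * _); under eq_bigr do rewrite row.
  rewrite sumrB sumr_const card_ord; congr (_ - _); first by rewrite expr2 mulr_natl.
  rewrite (partition_big (residue k0) predT) //=; apply: eq_bigr => i _.
  rewrite expr2 {1}/t part_sizeE big_distrl; apply: eq_big => [u|u /eqP -> /=].
    by rewrite in_setT.
  by rewrite mul1r part_sizeE.
set Q := q R _; move=> le4; rewrite -(ler_pM2r (_ : 0 < 2)) //.
have P1 : 0 <= k%:R :> R by rewrite ler0n.
have := ler_wpM2l P1 le4.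
have : k%:R * \sum_i (t i)%:R ^+ 2 <= n%:R ^+ 2 + k%:R ^+ 2 :> R.
  (* Equivalent to [(t i - p) * (t i - p - 1) = 0], which makes the sum of squares linear in the
     sizes. *)
  have tsq i : (t i)%:R ^+ 2 = (2 * p%:R + 1) * (t i)%:R - p%:R * (p%:R + 1) :> R.
    rewrite /t turan_part_size -/p natrD; case: (_ < _)%N => /=; ring.
  under eq_bigr do rewrite tsq.
  rewrite sumrB -big_distrr /= sumr_const card_ord -natr_sum sum_part_size cardsT card_ord.
  rewrite -[(_ * _) *+ k]mulr_natl -subr_ge0.
  set N : R := n%:R; set P : R := p%:R; set kk : R := k%:R.
  have -> : N ^+ 2 + kk ^+ 2 - kk * ((2 * P + 1) * N - kk * (P * (P + 1))) =
    (N - kk * P - kk / 2) ^+ 2 + 3 / 4 * kk ^+ 2 by field.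
  by apply: addr_ge0; [|apply: mulr_ge0]; rewrite ?sqr_ge0 //; lra.
by rewrite -mulr_natr; lra.
Qed.

(** * Harmonic sums *)

Definition harmonic_sum {R : realType} (m : nat) : R := \sum_(j < m) j.+1%:R^-1.

Lemma harmonic_sumS (R : realType) (m : nat) :
  harmonic_sum m.+1 = harmonic_sum m + m.+1%:R^-1 :> R.
Proof. exact: big_ord_recr. Qed.

Lemma harmonic_sum_le (R : realType) (m n : nat) :
  (m <= n)%N -> harmonic_sum m <= harmonic_sum n :> R.
Proof.
move=> /subnKC <-; elim: (n - m)%N => [|d IH]; first by rewrite addn0.
by rewrite addnS harmonic_sumS (le_trans IH) // lerDl invr_ge0 ler0n.
Qed.

Lemma harmonic_sum_lt (R : realType) (m n : nat) :
  (m < n)%N -> harmonic_sum m + n%:R^-1 <= harmonic_sum n :> R.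
Proof.
case: n => // n; rewrite ltnS => mn.
by rewrite harmonic_sumS lerD2r harmonic_sum_le.
Qed.

Lemma harmonic_sum_double (R : realType) (m : nat) :
  (0 < m)%N -> harmonic_sum m + 2^-1 <= harmonic_sum (2 * m) :> R.
Proof.
(* Each of the [d] added terms is at least the last one, the inverse of [m + d]. *)
move=> m0; have H d : harmonic_sum m + d%:R / (m + d)%:R <= harmonic_sum (m + d) :> R.
  elim: d => [|d IH]; first by rewrite addn0 mul0r addr0.
  rewrite addnS harmonic_sumS -[d.+1%:R]natr1 mulrDl mul1r addrA lerD2r.
  apply: le_trans IH; rewrite lerD2l ler_wpM2l // lef_pV2 ?posrE ?ltr0n ?ler_nat //.
  by rewrite addn_gt0 m0.
have := H m; rewrite addnn -mul2n natrM invfM mulrCA divff ?mulr1 //.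
by rewrite pnatr_eq0 -lt0n.
Qed.

Lemma harmonic_sum_expn (R : realType) (m s : nat) :
  (0 < m)%N -> harmonic_sum m + s%:R / 2 <= harmonic_sum (2 ^ s * m) :> R.
Proof.
move=> m0; elim: s => [|s IH]; first by rewrite mul0r addr0 mul1n.
have := @harmonic_sum_double R (2 ^ s * m); rewrite muln_gt0 expn_gt0 m0 => /(_ isT).
by rewrite expnS -mulnA -[s.+1%:R]natr1; lra.
Qed.

(** * Dense induced subgraphs and the comparison with the Turan graph *)

Lemma colouring_of_small_js (R : realType) (n k : nat) (e : rel 'I_n) (S : {set 'I_n})
    (eps : R) :
  simple_graph e -> (2 <= k)%N -> (0 < #|S|)%N -> 0 < eps ->
  5 * k%:R ^+ 4 * (k.+1%:R * eps) <= 1 ->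
  (forall v, v \in S -> #|S :\: [set w | e v w]|%:R <= (k%:R^-1 + eps) * #|S|%:R) ->
  ((k - 1)`! * js k.+1 e)%:R < (eps * #|S|%:R) ^+ (k - 1) ->
  exists c : 'I_n -> 'I_k, {in S &, forall u v, c u = c v -> ~~ e u v}.
Proof.
move=> sg k2 S0 eps0 epsk hD hjs.
have [K [f [cK fK proper]]] := multipartite_of_small_js sg k2 S0 eps0 epsk hD hjs.
have [v0 v0K] : exists v, v \in K by apply/set0Pn; rewrite -card_gt0 cK; lia.
exists (fun w => cast_ord cK (enum_rank_in v0K (f w))) => u v uS vS /cast_ord_inj h.
by apply: proper => //; apply: (enum_rank_in_inj _ _ h); apply: fK.
Qed.

(* The potential whose maximizer is taken strictly increases by deleting a vertex
   as long as some degree is small. *)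
Definition potential {R : realType} {n : nat} (e : rel 'I_n) (b : R) (S : {set 'I_n}) : R :=
  q R (restr S e) / #|S|%:R + b * harmonic_sum #|S|.

(** Take a nonempty maximizer of [potential] with weight [eps / 8]. Deleting a vertex costs
    [eps / 8] over [#|S|] in the harmonic term, just what [delete_vertex] more than regains, so no
    degree is small. For a proper subset the lost harmonic term forces a gain in the ratio. *)
Lemma exists_dense_subset (R : realType) (n s : nat) (e : rel 'I_n) (eps : R) :
  simple_graph e -> (0 < n)%N -> 0 < eps <= 2^-1 ->
  32 < eps * s%:R -> 17 * 2 ^+ s <= eps * n%:R -> 5 / 4 * n%:R <= q R e ->
  exists S : {set 'I_n}, let m : R := #|S|%:R in [/\ (n <= 2 ^ s * #|S|)%N,
    q R e / n%:R * m <= q R (restr S e),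
    S != setT -> (q R e / n%:R + eps / 8 / n%:R) * m <= q R (restr S e) &
    forall u, u \in S -> q R (restr S e) / 2 - eps * m < (deg (restr S e) u)%:R].
Proof.
move=> sg n0 /andP[e0 e1] hs hn q54; have [sym irr] := sg.
have T0 : [set: 'I_n] != set0 by rewrite -card_gt0 cardsT card_ord.
have [S Sn0 Smax] := @arg_maxP _ R _ setT (fun S : {set 'I_n} => S != set0)
  (potential e (eps / 8)) T0.
exists S => m; have m0N : (0 < #|S|)%N by rewrite card_gt0.
have m0 : 0 < m by rewrite ltr0n.
have nR : 0 < n%:R :> R by rewrite ltr0n.
have mn : (#|S| <= n)%N by rewrite -[leqRHS]card_ord max_card.
have b0 : 0 < eps / 8 by clear -e0; lra.
have FT := Smax setT T0; rewrite /= /potential restr_setT cardsT card_ord -/m in FT.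
have hmn : harmonic_sum #|S| <= harmonic_sum n :> R by apply: harmonic_sum_le.
have bh : eps / 8 * harmonic_sum #|S| <= eps / 8 * harmonic_sum n by rewrite ler_pM2l.
have qle : q R (restr S e) / m <= 2.
  by rewrite ler_pdivrMr //; apply: q_le_card.
have th54 : 5 / 4 <= q R e / n%:R by rewrite ler_pdivlMr.
(* Otherwise the harmonic term drops by at least [s%:R / 2], costing [eps * s%:R / 16], more than 2,
   whereas the ratio never exceeds 2. *)
have big : (n <= 2 ^ s * #|S|)%N.
  rewrite leqNgt; apply/negP => lt.
  have h1 := harmonic_sum_expn R s m0N.
  have h2 : harmonic_sum (2 ^ s * #|S|) <= harmonic_sum n :> R by apply/harmonic_sum_le/ltnW.
  have h3 : eps / 8 * (s%:R / 2) <= eps / 8 * (harmonic_sum n - harmonic_sum #|S|).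
    by rewrite ler_pM2l //; clear -h1 h2; lra.
  by clear -h3 FT qle th54 hs; lra.
have thS : q R e / n%:R <= q R (restr S e) / m by clear -FT bh; lra.
have em : 17 <= eps * m.
  have p0 : 0 < 2 ^+ s :> R by rewrite exprn_gt0.
  have h1 : n%:R <= 2 ^+ s * m :> R by rewrite -natrX -natrM ler_nat.
  have h2 : eps * n%:R <= eps * (2 ^+ s * m) by rewrite ler_pM2l.
  by rewrite -(ler_pM2r p0); clear -h2 hn; lra.
split=> [//||ST|u uS]; first by rewrite -ler_pdivlMr.
  rewrite -ler_pdivlMr //.
  have ltmn : (#|S| < n)%N.
    rewrite ltn_neqAle mn andbT; apply: contraNneq ST => h.
    by rewrite eqEcard subsetT cardsT card_ord; apply: eq_leq; exact: esym h.
  have h1 : eps / 8 * n%:R^-1 <= eps / 8 * (harmonic_sum n - harmonic_sum #|S|).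
    by rewrite ler_pM2l // lerBrDl harmonic_sum_lt.
  by clear -h1 FT; lra.
rewrite ltNge; apply/negP => du.
have q54S : 5 / 4 * m <= q R (restr S e) by rewrite -ler_pdivlMr // (le_trans th54).
have e12 : 0 < eps <= 2^-1 by rewrite e0.
have em16 : 16 < eps * #|S|%:R by rewrite -/m; clear -em; lra.
have [w wS] := delete_vertex sg uS e12 em16 q54S du.
rewrite -/m => qw.
have m17 : 17 <= m.
  have h : eps * m <= 1 * m by rewrite ler_pM2r //; clear -e1; lra.
  by clear -h em; lra.
have cw : #|S| = (#|S :\ w|).+1 by rewrite (cardsD1 w S) wS.
have cwR : #|S :\ w|%:R = m - 1 :> R by rewrite /m cw -natr1 addrK.
have m1 : 0 < m - 1 by clear -m17; lra.
have w0 : S :\ w != set0 by rewrite -card_gt0 -(ltr0n R) cwR.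
have := Smax _ w0; rewrite /= /potential -/m cwR.
have -> : harmonic_sum #|S| = harmonic_sum #|S :\ w| + m^-1 :> R.
  by rewrite {1}cw harmonic_sumS -cw.
move=> le; have : q R (restr (S :\ w) e) / (m - 1) <= (q R (restr S e) + eps / 8) / m.
  by rewrite mulrDl; clear -le; lra.
rewrite ler_pdivrMr // mulrAC ler_pdivlMr // leNgt; apply/negP/negPn.
by [].
Qed.

Theorem theorem2p9 (R : realType) (k : nat) : (3 <= k)%N ->
  exists (c : R) (n0 : nat), 0 < c /\
    forall (n : nat) (e : rel 'I_n), (n0 <= n)%N ->
      simple_graph e ->
      q R (turan n k) <= q R e ->
      ~ isomorphic e (turan n k) ->
      c * (n%:R ^+ (k - 1)) <= (js (k.+1) e)%:R.
Proof.
move=> k3; have k0 : (0 < k)%N by lia.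
have kk3 : 3 <= k%:R :> R by rewrite ler_nat.
set kk : R := k%:R in kk3.
(* The colouring is applied with [2 * eps], for which its smallness condition holds with
   equality. *)
pose eps : R := (10 * kk ^+ 4 * (kk + 1))^-1.
have kk4 : 81 <= kk ^+ 4.
  have : 9 <= kk ^+ 2 by nra.
  have -> : kk ^+ 4 = kk ^+ 2 * kk ^+ 2 by ring.
  by nra.
have ep0 : 0 < 10 * kk ^+ 4 * (kk + 1) by rewrite !mulr_gt0 //; lra.
have eps0 : 0 < eps by rewrite invr_gt0.
have epsE : 10 * kk ^+ 4 * (kk + 1) * eps = 1 by rewrite mulfV // gt_eqF.
have eps24 : eps <= 24^-1.
  rewrite lef_pV2 ?posrE //; nra.
pose s := Num.bound (32 / eps).
have hs : 32 < eps * s%:R.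
  have : 32 / eps < s%:R by apply: archi_boundP; rewrite divr_ge0 // ltW.
  by rewrite ltr_pdivrMr // mulrC.
pose n0 := Num.bound (17 * kk * 2 ^+ s / eps).
have two0 : 0 < 2 ^+ s :> R by rewrite exprn_gt0.
have two1 : 1 <= 2 ^+ s :> R by apply: exprn_ege1; lra.
(* The set found below has at least [n / 2 ^ s] vertices, and greedy counting carries the factor
   [(k - 1)]!. *)
exists ((eps / 2 ^+ s) ^+ (k - 1) / (k - 1)`!%:R), n0.+1; split.
  by rewrite divr_gt0 ?exprn_gt0 ?divr_gt0 // ltr0n fact_gt0.
move=> n e n0n sg qT niso; have [sym irr] := sg.
have n1 : (0 < n)%N by apply: leq_trans n0n.
have nR : 0 < n%:R :> R by rewrite ltr0n.
have nbig : 17 * kk * 2 ^+ s < eps * n%:R.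
  have h1 : 17 * kk * 2 ^+ s / eps < n0%:R.
    by apply: archi_boundP; rewrite divr_ge0 ?mulr_ge0 ?(ltW two0) ?(ltW eps0) //; lra.
  have h2 : n0%:R <= n%:R :> R by rewrite ler_nat ltnW.
  by have := lt_le_trans h1 h2; rewrite ltr_pdivrMr // [n%:R * _]mulrC.
have nbig17 : 17 * 2 ^+ s <= eps * n%:R.
  by apply: le_trans (ltW nbig); rewrite ler_pM2r //; clear -kk3; lra.
have nbigk : 17 * kk < eps * n%:R.
  by apply: le_lt_trans nbig; rewrite -[leLHS]mulr1 ler_pM2l //; clear -kk3; lra.
set N : R := n%:R in nR nbig nbig17 nbigk *.
have qTge := q_turan_ge R n1 k0; rewrite -/kk -/N in qTge.
(* With [th = q / n], this reads [th >= 2 (1 - 1/k) - 2 k / n^2]. *)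
pose th := q R e / N.
have qe : q R e = th * N by rewrite /th mulfVK // gt_eqF.
have thT : 2 * (kk - 1) - 2 * kk ^+ 2 / N ^+ 2 <= kk * th.
  have N2 : 0 < N ^+ 2 by rewrite exprn_gt0.
  rewrite -(ler_pM2r N2) mulrBl mulfVK ?gt_eqF //.
  have h1 : kk * (q R (turan n k) * N) <= kk * (q R e * N).
    by rewrite ler_pM2l ?ler_pM2r //; clear -kk3; lra.
  by have := le_trans qTge h1; rewrite qe => h; clear -h; lra.
have N2 : 0 < N ^+ 2 by rewrite exprn_gt0.
(* The deficit of [th] is of order $1/n^2$, below the gain of order $1/n$ that a proper subset would
   bring. *)
have kN : 2 * kk ^+ 2 / N ^+ 2 < kk * (eps / 8 / N).
  rewrite ltr_pdivrMr //.
  have -> : kk * (eps / 8 / N) * N ^+ 2 = kk * (eps * N) / 8 by field; rewrite gt_eqF.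
  have h : kk * (17 * kk) < kk * (eps * N) by rewrite ltr_pM2l //; clear -kk3; lra.
  by have h2 := sqr_ge0 kk; clear -h h2; lra.
have NkN : 17 * kk < N.
  by apply: lt_le_trans nbigk _; rewrite -[leRHS]mul1r ler_pM2r //; clear -eps24; lra.
have epsN : kk * (eps / 8 / N) <= kk * (eps / 8).
  rewrite ler_pM2l; last by clear -kk3; lra.
  by rewrite ler_pdivrMr // -[leLHS]mulr1 ler_pM2l //; [clear -kk3 NkN|clear -eps0]; lra.
have kk0 : 0 < kk by clear -kk3; lra.
have keps : kk * eps <= kk * 24^-1 by rewrite ler_pM2l.
have th54 : 5 / 4 <= th by rewrite -(ler_pM2l kk0); clear -keps epsN kN thT kk3; lra.
have q54 : 5 / 4 * N <= q R e by rewrite qe ler_pM2r.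
rewrite leNgt; apply/negP => small.
have eps12 : 0 < eps <= 2^-1 by rewrite eps0; clear -eps24; lra.
have [S [big thS thST dS]] := exists_dense_subset sg n1 eps12 hs nbig17 q54.
rewrite -/N -/th in thS thST; set m : R := #|S|%:R in thS thST dS.
have S0 : (0 < #|S|)%N by rewrite lt0n; apply: contraTneq big => ->; rewrite muln0 -ltnNge.
have m0 : 0 < m by rewrite ltr0n.
have bigR : N <= 2 ^+ s * m by rewrite -natrX -natrM ler_nat.
have [c proper] : exists c : 'I_n -> 'I_k, {in S &, forall u v, c u = c v -> ~~ e u v}.
  apply: (@colouring_of_small_js R n k e S (2 * eps) sg (ltnW k3) S0).
  - by rewrite mulr_gt0.
  - by rewrite -natr1 -/kk; clear -epsE; lra.
  - move=> v vS; rewrite -/kk -/m.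
    have : (#|S :\: [set w | e v w]| + deg (restr S e) v = #|S|)%N.
      rewrite addnC -(cardsID [set w | e v w] S); congr (_ + _)%N.
      by apply: eq_card => w; rewrite !inE /restr vS.
    move/(congr1 (fun a => a%:R : R)); rewrite natrD -/m => cS.
    have dv := dS v vS.
    rewrite -(ler_pM2l kk0).
    have -> : kk * ((kk^-1 + 2 * eps) * m) = m + kk * (2 * eps * m) by field; rewrite gt_eqF.
    have h1 : (2 * (kk - 1) - kk * (eps / 8)) * m <= kk * th * m.
      by rewrite ler_pM2r //; clear -epsN kN thT; lra.
    have h2 : kk * (th * m) <= kk * q R (restr S e) by rewrite ler_pM2l.
    have h3 : kk * (q R (restr S e) / 2 - eps * m) <= kk * (deg (restr S e) v)%:R.
      by rewrite ler_pM2l // ltW.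
    have h4 : 0 <= kk * eps * m by rewrite !mulr_ge0 // ltW.
    clear -cS h1 h2 h3 h4; move: (q R _) (deg _ v)%:R cS h2 h3 => Q d cS h2 h3.
    have -> : #|S :\: [set w | e v w]|%:R = m - d by clear -cS; lra.
    by clear -h1 h2 h3 h4; lra.
  - have f0 : 0 < (k - 1)`!%:R :> R by rewrite ltr0n fact_gt0.
    rewrite natrM -/m mulrC -ltr_pdivlMr //; apply: lt_le_trans small _.
    rewrite -/N mulrAC ler_pM2r ?invr_gt0 // -exprMn.
    have h0 : 0 <= eps / 2 ^+ s * N by apply/ltW/mulr_gt0 => //; apply: divr_gt0.
    have h : eps / 2 ^+ s * N <= 2 * eps * m.
      rewrite mulrAC ler_pdivrMr //.
      have h1 : eps * N <= eps * (2 ^+ s * m) by rewrite ler_pM2l.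
      have h2 : 0 <= eps * (2 ^+ s * m) by rewrite !mulr_ge0 ?ltW.
      by clear -h1 h2; lra.
    by rewrite lerXn2r // nnegrE // (le_trans h0 h).
have kQ := @q_multipartite_le R n k S e c n1 (ltnW k3) sym proper.
rewrite -/kk -/m in kQ.
(* For a proper subset the gained ratio would exceed the bound for [k]-partite graphs. *)
have ST : S = setT.
  apply/eqP; apply/negPn/negP => /thST h.
  have h1 : kk * (th + eps / 8 / N) * m <= 2 * (kk - 1) * m.
    by apply: le_trans kQ; rewrite -mulrA ler_pM2l.
  have : kk * (th + eps / 8 / N) <= 2 * (kk - 1) by rewrite -(ler_pM2r m0).
  by clear -kN thT; lra.
rewrite {}ST in proper.
have cardT : #|[set: 'I_n]|%:R = N by rewrite cardsT card_ord.
have [symT _] := simple_turan n k.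
have aT : 0 < q R (restr setT (turan n k)) - #|[set: 'I_n]|%:R.
  rewrite restr_setT cardT subr_gt0 -(ltr_pM2r nR) -(ltr_pM2l kk0).
  apply: lt_le_trans qTge.
  have h1 : 17 * kk * (17 * kk) <= N ^+ 2.
    by rewrite expr2; apply: ler_pM; clear -kk3 NkN; lra.
  have h2 : 3 * N ^+ 2 <= kk * N ^+ 2 by rewrite ler_pM2r.
  have h3 : 0 < kk ^+ 2 by rewrite exprn_gt0.
  by clear -h1 h2 h3; lra.
have aG : 0 < q R (restr setT e) - #|[set: 'I_n]|%:R by rewrite restr_setT cardT; clear -q54 nR; lra.
have properT : {in setT &, forall u v : 'I_n,
    residue k0 u = residue k0 v -> ~~ turan n k u v}.
  by move=> u v _ _ h; rewrite turanE h eqxx.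
have [_ [_ fullT]] := part_sum_ge1 n1 symT properT aT.
have leT := fullT (fun u v _ _ h => h).
have [geG [fullG _]] := part_sum_ge1 n1 sym proper aG.
have aa : 0 < q R (restr setT (turan n k)) - #|[set: 'I_n]|%:R
    <= q R (restr setT e) - #|[set: 'I_n]|%:R by rewrite aT /= !restr_setT lerD2r.
have sizesT i : part_size setT (@residue n k k0) i = (n %/ k)%N \/
    part_size setT (@residue n k k0) i = (n %/ k).+1.
  by rewrite turan_part_size; case: (_ < _)%N; rewrite ?addn1 ?addn0; [right|left].
(* The Turan graph has sum at most 1 and [e] at least 1 with a no smaller [a], so the sizes are
   balanced and equality makes [e] complete between parts. *)
have [sizes leG] := part_sum_balanced aa (etrans (sum_part_size setT c) (esym (sum_part_size setT _)))
  sizesT leT geG.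
apply: niso; apply: (isomorphic_turan k0 _ sizes) => u v.
have [cuv|cuv] := eqVneq (c u) (c v); first by apply/negbTE/proper.
by apply: (fullG leG).
Qed.
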